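(* Assume hypotheses (J1)–(J3) below, assume moreover that there is $\rho>0$ such that every $J^{(N)}$ extends analytically to the strip $|\operatorname{Im}t|<\rho$ and is bounded there uniformly in $N$, and that $L^{(n_{\mathrm{TS}})}_{\mathrm{TS}}(\omega_f)$ is invertible for all odd $n_{\mathrm{TS}}$ with $\sup_{n_{\mathrm{TS}}}\|(L^{(n_{\mathrm{TS}})}_{\mathrm{TS}})^{-1}\|_2<\infty$. Let $\sigma_\infty=\lim_{N\to\infty}\sigma^{(N)}$ (which exists under (J1)–(J3)). Then there exist constants $C'>0$ and $\alpha'>0$ such that for every odd $n_{\mathrm{TS}}\ge3$, $$|\sigma^{(n_{\mathrm{TS}})}_{\mathrm{TS}}-\sigma_\infty|\le C' e^{-\alpha' n_{\mathrm{TS}}}.$$ Hypotheses (with $C,M,\alpha>0$ independent of $N,k$): (J1) $\|\hat{J}^{(N)}_k\|_2\le Ce^{-\alpha|k|}$ for all $N\in\{1,2,\dots\}\cup\{\infty\}$, $k\in\mathbb{Z}$; (J2) $\|\hat{J}^{(N)}_k-\hat{J}^{(\infty)}_k\|_2\le Ce^{-\alpha N}$ for all $N\ge1$, $|k|\le N$; (J3) $\|(L^{(N)}_{\mathrm{HR}})^{-1}\|_2\le M$ and $\|(A^{(N)}_k)^{-1}\|_2\le M$ for all $N\ge1$, $k\in\mathbb{Z}$.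
   Context: Let $n,m\ge1$, $B\in\mathbb{C}^{n\times m}$, $\omega_0>0$, $T_0=2\pi/\omega_0$, $\omega_f\in\mathbb{R}$, $j$ the imaginary unit. For each $N\in\{1,2,\dots\}\cup\{\infty\}$ let $J^{(N)}:\mathbb{R}\to\mathbb{C}^{n\times n}$ be continuous and $T_0$-periodic with Fourier coefficients $\hat{J}^{(N)}_k=\frac{1}{T_0}\int_0^{T_0}J^{(N)}(t)e^{-jk\omega_0t}dt$. Harmonic resolvent: $L^{(N)}_{\mathrm{HR}}$ is the block matrix indexed by $k,\ell\in\{-N,\dots,N\}$ with blocks $\delta_{k\ell}j(\omega_f+k\omega_0)I_n-\hat{J}^{(N)}_{k-\ell}$; $A^{(N)}_k=j(\omega_f+k\omega_0)I_n-\hat{J}^{(N)}_0$; $B^{(N)}_{\mathrm{HR}}$ has $B$ in the $k=0$ block row and zeros elsewhere; $\sigma^{(N)}$ is the largest singular value of $(L^{(N)}_{\mathrm{HR}})^{-1}B^{(N)}_{\mathrm{HR}}$. Time-spectral resolvent: for odd $n_{\mathrm{TS}}=2N+1$, let $\theta_i=2\pi i/n_{\mathrm{TS}}$, $i=0,\dots,n_{\mathrm{TS}}-1$, and let $D\in\mathbb{R}^{n_{\mathrm{TS}}\times n_{\mathrm{TS}}}$ be the Fourier spectral differentiation matrix, $D_{ik}=\tfrac12(-1)^{i-k}\csc\!\big(\pi(i-k)/n_{\mathrm{TS}}\big)$ for $i\ne k$ and $D_{ii}=0$. Let $J_{\mathrm{block}}=\mathrm{blkdiag}\big(J^{(N)}(\theta_0/\omega_0),\dots,J^{(N)}(\theta_{n_{\mathrm{TS}}-1}/\omega_0)\big)$,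 $J_{\mathrm{TS}}=J_{\mathrm{block}}-\omega_0(D\otimes I_n)$, $L^{(n_{\mathrm{TS}})}_{\mathrm{TS}}(\omega_f)=j\omega_fI-J_{\mathrm{TS}}$, and $B_{\mathrm{TS}}=n_{\mathrm{TS}}^{-1/2}(\mathbf{1}_{n_{\mathrm{TS}}}\otimes B)$ where $\mathbf{1}_{n_{\mathrm{TS}}}$ is the all-ones column vector. $\sigma^{(n_{\mathrm{TS}})}_{\mathrm{TS}}$ is the largest singular value of $(L^{(n_{\mathrm{TS}})}_{\mathrm{TS}})^{-1}B_{\mathrm{TS}}$. $\|\cdot\|_2$ is the induced 2-norm. *)

(* Defs.v *)
From HB Require Import structures.
From mathcomp Require Import all_boot all_order all_algebra.
From mathcomp Require Import all_classical all_reals all_analysis.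
From mathcomp.real_closed Require Import complex.
Import Order.TTheory GRing.Theory Num.Theory numFieldNormedType.Exports.

Set Implicit Arguments.
Unset Strict Implicit.
Unset Printing Implicit Defensive.

Local Open Scope ring_scope.
Local Open Scope classical_set_scope.

Definition toC {R : realType} (x : R) : R[i] := Complex x 0.
Definition jC {R : realType} : R[i] := Complex 0 1.
Definition expj {R : realType} (th : R) : R[i] := Complex (cos th) (sin th).

Definition cre {R : realType} (z : R[i]) : R := complex.Re z.
Definition cim {R : realType} (z : R[i]) : R := complex.Im z.

Definition cnorm {R : realType} (z : R[i]) : R :=
  Num.sqrt (cre z ^+ 2 + cim z ^+ 2).

Definition vnorm {R : realType} {p : nat} (x : 'cV[R[i]]_p) : R :=
  Num.sqrt (\sum_(i < p) (cre (x i 0) ^+ 2 + cim (x i 0) ^+ 2)).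

Definition opnorm {R : realType} {p q : nat} (A : 'M[R[i]]_(p, q)) : R :=
  sup [set r : R | exists x : 'cV[R[i]]_q, vnorm x = 1 /\ r = vnorm (A *m x)].

Definition adjmx {R : realType} {p q : nat} (A : 'M[R[i]]_(p, q)) : 'M[R[i]]_(q, p) :=
  map_mx (@conjc R) A^T.

Definition sigma_max {R : realType} {p q : nat} (A : 'M[R[i]]_(p, q)) : R :=
  sup [set s : R | exists a : R[i], eigenvalue (adjmx A *m A) a /\ s = Num.sqrt (cre a)].

Definition period {R : realType} (w0 : R) : R := 2 * pi / w0.

Definition fourier_coef {R : realType} {n : nat} (w0 : R) (J : R -> 'M[R[i]]_n)
    (k : int) : 'M[R[i]]_n :=
  \matrix_(i, j)
    Complex
      ((period w0)^-1 * Rintegral (@lebesgue_measure R) `[0, period w0]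
          (fun t => cre (J t i j * expj (- (k%:~R * w0 * t)))))
      ((period w0)^-1 * Rintegral (@lebesgue_measure R) `[0, period w0]
          (fun t => cim (J t i j * expj (- (k%:~R * w0 * t))))).

(* harmonic index k = i - N for block index i : 'I_(2N+1) *)
Definition hidx (N : nat) (i : 'I_(2 * N + 1)) : int := (i : nat)%:Z - N%:Z.

Definition L_HR {R : realType} {n : nat} (w0 wf : R) (J : R -> 'M[R[i]]_n) (N : nat)
    : 'M[R[i]]_(\sum_(i < 2 * N + 1) n) :=
  \mxblock_(i < 2 * N + 1, l < 2 * N + 1)
    ((if i == l then (jC * toC (wf + (hidx i)%:~R * w0))%:M else 0)
       - fourier_coef w0 J (hidx i - hidx l)).

Definition A_k {R : realType} {n : nat} (w0 wf : R) (J : R -> 'M[R[i]]_n) (k : int)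
    : 'M[R[i]]_n :=
  (jC * toC (wf + k%:~R * w0))%:M - fourier_coef w0 J 0.

Definition B_HR {R : realType} {n m : nat} (B : 'M[R[i]]_(n, m)) (N : nat)
    : 'M[R[i]]_(\sum_(i < 2 * N + 1) n, m) :=
  \mxcol_(i < 2 * N + 1) (if hidx i == 0 then B else 0).

Definition sigma_HR {R : realType} {n m : nat} (w0 wf : R) (J : R -> 'M[R[i]]_n)
    (B : 'M[R[i]]_(n, m)) (N : nat) : R :=
  sigma_max (invmx (L_HR w0 wf J N) *m B_HR B N).

(* Fourier spectral differentiation matrix of size p *)
Definition Dspec {R : realType} (p : nat) : 'M[R]_p :=
  \matrix_(i, k)
    (if i == k then 0
     else 2^-1 * ((-1) ^ ((i : nat)%:Z - (k : nat)%:Z))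
            / sin (pi * ((i : nat)%:R - (k : nat)%:R) / p%:R)).

Definition J_TS {R : realType} {n : nat} (w0 : R) (J : R -> 'M[R[i]]_n) (p : nat)
    : 'M[R[i]]_(\sum_(i < p) n) :=
  \mxdiag_(i < p) J (2 * pi * (i : nat)%:R / p%:R / w0)
  - \mxblock_(i < p, k < p) ((toC (w0 * Dspec p i k))%:M : 'M[R[i]]_n).

Definition L_TS {R : realType} {n : nat} (w0 wf : R) (J : R -> 'M[R[i]]_n) (p : nat)
    : 'M[R[i]]_(\sum_(i < p) n) :=
  (jC * toC wf)%:M - J_TS w0 J p.

Definition B_TS {R : realType} {n m : nat} (B : 'M[R[i]]_(n, m)) (p : nat)
    : 'M[R[i]]_(\sum_(i < p) n, m) :=
  \mxcol_(i < p) (toC (Num.sqrt (p%:R : R))^-1 *: B).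

(* sigma_TS for n_TS = 2N+1, built from J^(N) *)
Definition sigma_TS {R : realType} {n m : nat} (w0 wf : R) (J : R -> 'M[R[i]]_n)
    (B : 'M[R[i]]_(n, m)) (N : nat) : R :=
  sigma_max (invmx (L_TS w0 wf J (2 * N + 1)) *m B_TS B (2 * N + 1)).

Definition cdifferentiable_at {R : realType} (f : R[i] -> R[i]) (z : R[i]) : Prop :=
  exists l : R[i], forall eps : R, 0 < eps -> exists delta : R, 0 < delta /\
    forall h : R[i], h != 0 -> cnorm h < delta ->
      cnorm ((f (z + h) - f z) / h - l) < eps.

Definition holomorphic_on {R : realType} (S : set R[i]) (f : R[i] -> R[i]) : Prop :=
  forall z, S z -> cdifferentiable_at f z.

Definition strip {R : realType} (rho : R) : set R[i] := [set z | `|cim z| < rho].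

Definition analytic_strip_bounded {R : realType} {n : nat} (rho K : R)
    (J : R -> 'M[R[i]]_n) : Prop :=
  exists F : R[i] -> 'M[R[i]]_n,
    (forall t : R, F (toC t) = J t) /\
    (forall i j, holomorphic_on (strip rho) (fun z => F z i j)) /\
    (forall z, strip rho z -> opnorm (F z) <= K).

Definition cont_periodic {R : realType} {n : nat} (w0 : R) (J : R -> 'M[R[i]]_n) : Prop :=
  (forall i j, continuous (fun t => cre (J t i j)) /\ continuous (fun t => cim (J t i j))) /\
  (forall t, J (t + period w0) = J t).

(* Main.v *)
Require Import Defs.
From HB Require Import structures.
From mathcomp Require Import all_boot all_order all_algebra.
From mathcomp Require Import all_classical all_reals all_analysis.
From mathcomp.real_closed Require Import complex.
From mathcomp Require Import ring lra zify.
Import Order.TTheory GRing.Theory Num.Theory numFieldNormedType.Exports.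
Local Open Scope ring_scope.
Local Open Scope classical_set_scope.

Set Implicit Arguments.
Unset Strict Implicit.
Unset Printing Implicit Defensive.

(* Let [x] solve the harmonic-resolvent system with right-hand side [B v]. Weighting
   its blocks by [exp (be |k|)] perturbs the system by an operator of small norm (Schur
   test), so the blocks of [x] decay exponentially in [|k|]. Padding [x] with zeros then
   almost solves every larger truncation, hence the singular values form a Cauchy
   sequence with an exponential rate. Sampling the trigonometric polynomial with
   coefficients [x] on the time grid is an isometry, and [Dspec] differentiates
   harmonics of order at most [N] exactly, so the samples solve the time-spectral system
   up to the tails of the Fourier series of [J^(N)], which are exponentially small on
   the range where [x] is not. The Fourier series represents [J^(N)] pointwise by
   Fejer's theorem, its coefficients being summable. *)

(** The truncated systems have different dimensions, but all of them are driven by the same input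
    space. Singular values are therefore compared through the output norms of a common input [v],
    and no singular vector is followed from one truncation to the next.

    The bound [M] controls sizes in the 2-norm only and does not say which harmonics carry [x]. Both
    errors, cutting at [N] and truncating the series of [J^(N)] on the grid, sit near the edge
    [|k| = N], so they are small only once [x] is known to be small there. The weight changes the
    system by an amount proportional to [be]; this rate is taken so small that [M] times the change
    is at most 1/2 and can be absorbed.

    Exponents are regularly shared in halves: one half becomes the rate in [N], the other keeps sums
    over harmonics bounded independently of the dimension. Fejer's theorem links the coefficients,
    which enter (J1)-(J3), to the point values of [J^(N)] seen by the grid. *)

(** * The modulus on [R[i]] and the embedding of the reals *)

Section ComplexModulus.
Variable R : realType.
Implicit Types z w : R[i].

Lemma cnormE z : cnorm z = Normc.normc z.
Proof. by case: z. Qed.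

Lemma cnorm_ge0 z : 0 <= cnorm z.
Proof. exact: sqrtr_ge0. Qed.

Lemma cnorm_sqr z : cnorm z ^+ 2 = cre z ^+ 2 + cim z ^+ 2.
Proof. by rewrite sqr_sqrtr ?addr_ge0 ?sqr_ge0. Qed.

Lemma cnorm0 : cnorm (0 : R[i]) = 0.
Proof. by rewrite cnormE Normc.normc0. Qed.

Lemma cnorm_eq0 z : cnorm z = 0 -> z = 0.
Proof. by rewrite cnormE; exact: Normc.eq0_normc. Qed.

Lemma cnormM z w : cnorm (z * w) = cnorm z * cnorm w.
Proof. by rewrite !cnormE Normc.normcM. Qed.

Lemma cnormD z w : cnorm (z + w) <= cnorm z + cnorm w.
Proof. by rewrite !cnormE le_normcD. Qed.

Lemma cnormN z : cnorm (- z) = cnorm z.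
Proof. by rewrite !cnormE normcN. Qed.

Lemma cnorm_toC (x : R) : cnorm (toC x) = `|x|.
Proof. by rewrite /cnorm /= expr0n /= addr0 sqrtr_sqr. Qed.

Lemma cnorm_expj (x : R) : cnorm (expj x) = 1.
Proof. by rewrite /cnorm /= cos2Dsin2 sqrtr1. Qed.

Lemma cnorm_sum (I : Type) (r : seq I) (P : pred I) (F : I -> R[i]) :
  cnorm (\sum_(i <- r | P i) F i) <= \sum_(i <- r | P i) cnorm (F i).
Proof.
elim/big_rec2: _ => [|i x y _ h]; first by rewrite cnorm0.
by apply: le_trans (cnormD _ _) _; rewrite lerD2l.
Qed.

Lemma cnorm_le_reim z : cnorm z <= `|cre z| + `|cim z|.
Proof.
rewrite -[X in _ <= X]ger0_norm ?addr_ge0// -sqrtr_sqr ler_wsqrtr//.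
rewrite sqrrD !real_normK ?num_real// addrAC lerDl.
by rewrite mulrn_wge0// mulr_ge0.
Qed.

Lemma cre_sum (I : Type) (r : seq I) (P : pred I) (F : I -> R[i]) :
  cre (\sum_(i <- r | P i) F i) = \sum_(i <- r | P i) cre (F i).
Proof. by elim/big_rec2: _ => // i x y _ <-; case: (F i); case: y. Qed.

Lemma cim_sum (I : Type) (r : seq I) (P : pred I) (F : I -> R[i]) :
  cim (\sum_(i <- r | P i) F i) = \sum_(i <- r | P i) cim (F i).
Proof. by elim/big_rec2: _ => // i x y _ <-; case: (F i); case: y. Qed.

Lemma creD (z w : R[i]) : cre (z + w) = cre z + cre w.
Proof. by case: z; case: w. Qed.

Lemma cimD (z w : R[i]) : cim (z + w) = cim z + cim w.
Proof. by case: z; case: w. Qed.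

Lemma creM (z w : R[i]) : cre (z * w) = cre z * cre w - cim z * cim w.
Proof. by case: z; case: w. Qed.

Lemma cimM (z w : R[i]) : cim (z * w) = cre z * cim w + cim z * cre w.
Proof. by case: z; case: w. Qed.

Lemma toCM (x y : R) : toC (x * y) = toC x * toC y.
Proof. by apply/eqP; rewrite eq_complex /= !mulr0 mul0r subr0 addr0 !eqxx. Qed.

Lemma toCD (x y : R) : toC (x + y) = toC x + toC y.
Proof. by apply/eqP; rewrite eq_complex /= addr0 !eqxx. Qed.

Lemma toC_sum (I : Type) (r : seq I) (F : I -> R) :
  toC (\sum_(i <- r) F i) = \sum_(i <- r) toC (F i).
Proof.
elim: r => [|i r ih]; first by rewrite !big_nil.
by rewrite !big_cons toCD ih.
Qed.

Lemma toC_nat (n : nat) : toC n%:R = n%:R :> R[i].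
Proof. by elim: n => // n ih; rewrite -natr1 toCD ih -natr1. Qed.

Lemma toC_int (k : int) : toC k%:~R = k%:~R :> R[i].
Proof.
case: k => q; first by rewrite -!pmulrn toC_nat.
rewrite NegzE !rmorphN /= -!pmulrn -toC_nat.
by apply/eqP; rewrite eq_complex /= oppr0 !eqxx.
Qed.

End ComplexModulus.

(** * Real Euclidean norms, Cauchy-Schwarz and the Schur test *)

Section EuclideanNorm.
Variable R : realType.

Definition l2 (I : finType) (u : I -> R) : R := Num.sqrt (\sum_i u i ^+ 2).

(** Lagrange's identity: the double sum of the squares [(a i * b j - a j * b i) ^+ 2] is twice the
    gap between the two sides. *)
Lemma cauchy_schwarz (I : finType) (a b : I -> R) :
  (\sum_i a i * b i) ^+ 2 <= (\sum_i a i ^+ 2) * (\sum_i b i ^+ 2).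
Proof.
have h : 0 <= \sum_i \sum_j (a i * b j - a j * b i) ^+ 2.
  by apply: sumr_ge0 => i _; apply: sumr_ge0 => j _; exact: sqr_ge0.
suff e : \sum_i \sum_j (a i * b j - a j * b i) ^+ 2 =
    ((\sum_i a i ^+ 2) * (\sum_i b i ^+ 2) - (\sum_i a i * b i) ^+ 2) *+ 2.
  by move: h; rewrite e pmulrn_lge0// subr_ge0.
rewrite mulr2n [X in _ = _ + (X - _)]mulrC expr2 !big_distrlr /= -!sumrB -big_split /=.
apply: eq_bigr => i _; rewrite -!sumrB -big_split /=.
by apply: eq_bigr => j _; ring.
Qed.

Section L2.
Variable I : finType.
Implicit Types u v : I -> R.

Lemma l2_ge0 u : 0 <= l2 u.
Proof. exact: sqrtr_ge0. Qed.

Lemma l2_sqr u : l2 u ^+ 2 = \sum_i u i ^+ 2.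
Proof. by rewrite sqr_sqrtr// sumr_ge0// => i _; exact: sqr_ge0. Qed.

Lemma le_l2 u v : (forall i, 0 <= u i <= v i) -> l2 u <= l2 v.
Proof.
move=> h; rewrite ler_wsqrtr// ler_sum// => i _.
by have /andP[u0 uv] := h i; rewrite lerXn2r// nnegrE// (le_trans u0).
Qed.

Lemma l2D u v : l2 (fun i => u i + v i) <= l2 u + l2 v.
Proof.
rewrite -(ler_pXn2r (n := 2))// ?nnegrE ?addr_ge0 ?l2_ge0// sqrrD !l2_sqr.
have -> : \sum_i (u i + v i) ^+ 2 =
    \sum_i u i ^+ 2 + (\sum_i u i * v i) *+ 2 + \sum_i v i ^+ 2.
  rewrite -sumrMnl -!big_split /=; apply: eq_bigr => i _; exact: sqrrD.
rewrite lerD2r lerD2l lerMn2r /=.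
apply: le_trans (ler_norm _) _.
rewrite -(ler_pXn2r (n := 2))// ?nnegrE ?mulr_ge0 ?l2_ge0//.
by rewrite real_normK ?num_real// exprMn !l2_sqr cauchy_schwarz.
Qed.

Lemma l2Z (c : R) u : 0 <= c -> l2 (fun i => c * u i) = c * l2 u.
Proof.
move=> c0; rewrite /l2; under eq_bigr do rewrite exprMn.
by rewrite -mulr_sumr sqrtrM ?sqr_ge0// sqrtr_sqr ger0_norm.
Qed.

Lemma ler_l2 u i : `|u i| <= l2 u.
Proof.
rewrite -sqrtr_sqr ler_wsqrtr// (bigD1 i)//= lerDl sumr_ge0// => j _.
exact: sqr_ge0.
Qed.

Lemma l2_le_sum u : (forall i, 0 <= u i) -> l2 u <= \sum_i u i.
Proof.
move=> u0; have s0 : 0 <= \sum_i u i by exact: sumr_ge0.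
rewrite -(ler_pXn2r (n := 2))// ?nnegrE ?l2_ge0// l2_sqr expr2 mulr_sumr.
apply: ler_sum => i _; rewrite expr2 ler_wpM2r//.
by rewrite (bigD1 i)//= lerDl sumr_ge0.
Qed.

End L2.

(** Writing each [g i j] as a product of two square roots, Cauchy-Schwarz in row [i] costs one row
    sum; exchanging the summations then costs one column sum. *)
Lemma schur_test (I J : finType) (g : I -> J -> R) (s : R) (u : J -> R) :
  0 <= s -> (forall i j, 0 <= g i j) ->
  (forall i, \sum_j g i j <= s) -> (forall j, \sum_i g i j <= s) ->
  l2 (fun i => \sum_j g i j * u j) <= s * l2 u.
Proof.
move=> s0 g0 gr gc.
rewrite -(ler_pXn2r (n := 2))// ?nnegrE ?mulr_ge0 ?l2_ge0// exprMn !l2_sqr.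
apply: (@le_trans _ _ (\sum_i s * (\sum_j g i j * u j ^+ 2))).
  apply: ler_sum => i _.
  have := cauchy_schwarz (fun j => Num.sqrt (g i j)) (fun j => Num.sqrt (g i j) * u j).
  under eq_bigr do rewrite mulrA -expr2 sqr_sqrtr//.
  under [X in _ <= X * _]eq_bigr do rewrite sqr_sqrtr//.
  under [X in _ <= _ * X]eq_bigr do rewrite exprMn sqr_sqrtr//.
  move/le_trans; apply; apply: ler_wpM2r => //.
  by apply: sumr_ge0 => j _; rewrite mulr_ge0// sqr_ge0.
rewrite -mulr_sumr exchange_big /= expr2 -mulrA ler_wpM2l// mulr_sumr.
apply: ler_sum => j _; rewrite -mulr_suml ler_wpM2r ?sqr_ge0//.
Qed.

End EuclideanNorm.

(** * Vector norms, block vectors and the induced norm *)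

Section VectorNorm.
Variable R : realType.

Section Basic.
Variable p : nat.
Implicit Types x y : 'cV[R[i]]_p.

Lemma vnormE x : vnorm x = l2 (fun i => cnorm (x i 0)).
Proof. by congr Num.sqrt; apply: eq_bigr => i _; rewrite cnorm_sqr. Qed.

Lemma vnorm_ge0 x : 0 <= vnorm x.
Proof. exact: sqrtr_ge0. Qed.

Lemma vnorm0 : vnorm (0 : 'cV[R[i]]_p) = 0.
Proof.
by rewrite /vnorm big1 ?sqrtr0// => i _; rewrite mxE /= expr0n addr0.
Qed.

Lemma vnorm_eq0 x : vnorm x = 0 -> x = 0.
Proof.
move=> x0; apply/matrixP => i j; rewrite ord1 mxE; apply: cnorm_eq0.
apply/eqP; rewrite eq_le cnorm_ge0 andbT -x0 vnormE.
exact: le_trans (ler_norm _) (ler_l2 _ i).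
Qed.

Lemma cnorm_le_vnorm x i : cnorm (x i 0) <= vnorm x.
Proof. by rewrite vnormE; exact: le_trans (ler_norm _) (ler_l2 _ i). Qed.

Lemma vnormD x y : vnorm (x + y) <= vnorm x + vnorm y.
Proof.
rewrite !vnormE; apply: le_trans (l2D _ _); apply: le_l2 => i.
by rewrite cnorm_ge0 mxE cnormD.
Qed.

Lemma vnormZ (c : R[i]) x : vnorm (c *: x) = cnorm c * vnorm x.
Proof.
rewrite !vnormE -l2Z ?cnorm_ge0//; congr Num.sqrt.
by apply: eq_bigr => i _; rewrite mxE cnormM.
Qed.

Lemma vnormN x : vnorm (- x) = vnorm x.
Proof. by rewrite -scaleN1r vnormZ cnormN -[1]/(toC 1) cnorm_toC normr1 mul1r. Qed.

Lemma vnormB x y : vnorm (x - y) = vnorm (y - x).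
Proof. by rewrite -vnormN opprB. Qed.

Lemma ler_dist_vnorm x y : `|vnorm x - vnorm y| <= vnorm (x - y).
Proof.
rewrite ler_norml; apply/andP; split.
  rewrite lerBrDl lerBlDr vnormB -{1}(subrK x y) addrC -vnormB.
  by rewrite vnormB addrC; apply: le_trans (vnormD _ _) _; rewrite addrC.
by rewrite lerBlDr -{1}(subrK y x); exact: vnormD.
Qed.

Lemma vnorm_sum (I : Type) (r : seq I) (P : pred I) (F : I -> 'cV[R[i]]_p) :
  vnorm (\sum_(i <- r | P i) F i) <= \sum_(i <- r | P i) vnorm (F i).
Proof.
elim/big_rec2: _ => [|i x y _ h]; first by rewrite vnorm0.
by apply: le_trans (vnormD _ _) _; rewrite lerD2l.
Qed.

End Basic.

Lemma vnorm_mxcol (p n : nat) (x : 'I_p -> 'cV[R[i]]_n) :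
  vnorm (\mxcol_i x i) = l2 (fun i => vnorm (x i)).
Proof.
rewrite /vnorm /l2; congr Num.sqrt.
under [RHS]eq_bigr => i _.
  rewrite sqr_sqrtr; last by apply: sumr_ge0 => j _; rewrite addr_ge0 ?sqr_ge0.
  over.
(* Rows of a block column correspond bijectively to pairs of a block and a row inside it. *)
rewrite [RHS]sig_big_dep /= [RHS](reindex _ tagnat.sig_bij_on) /=.
by apply: eq_bigr => k _; rewrite mxE.
Qed.

(** A crude bound for the operator norm. It shows that the supremum defining [opnorm] is finite, and
    later turns scalar Fourier estimates into a matrix estimate at the price of a factor [n * n]. *)
Definition entrysum (p q : nat) (A : 'M[R[i]]_(p, q)) : R :=
  \sum_i \sum_j cnorm (A i j).

Lemma vnorm_mul_entrysum (p q : nat) (A : 'M[R[i]]_(p, q)) x :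
  vnorm (A *m x) <= entrysum A * vnorm x.
Proof.
rewrite vnormE; apply: le_trans (l2_le_sum _) _ => [i|]; first exact: cnorm_ge0.
rewrite mulr_suml; apply: ler_sum => i _; rewrite mxE mulr_suml.
apply: le_trans (cnorm_sum _ _ _) _; apply: ler_sum => j _.
by rewrite cnormM ler_wpM2l ?cnorm_ge0// cnorm_le_vnorm.
Qed.

Lemma opnorm_has_ubound (p q : nat) (A : 'M[R[i]]_(p, q)) :
  has_ubound [set r : R | exists x : 'cV[R[i]]_q, vnorm x = 1 /\ r = vnorm (A *m x)].
Proof.
exists (entrysum A) => _ [x [x1 ->]].
by apply: le_trans (vnorm_mul_entrysum _ _) _; rewrite x1 mulr1.
Qed.

Lemma vnorm_mul_opnorm (p q : nat) (A : 'M[R[i]]_(p, q)) x :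
  vnorm (A *m x) <= opnorm A * vnorm x.
Proof.
have [/vnorm_eq0 ->|x0] := eqVneq (vnorm x) 0; first by rewrite mulmx0 !vnorm0 mulr0.
have xgt0 : 0 < vnorm x by rewrite lt_def x0 vnorm_ge0.
set c := toC (vnorm x)^-1.
have cE : cnorm c = (vnorm x)^-1 by rewrite cnorm_toC ger0_norm ?invr_ge0 ?vnorm_ge0.
have : vnorm (A *m (c *: x)) <= opnorm A.
  apply: ub_le_sup; first exact: opnorm_has_ubound.
  by exists (c *: x); split => //; rewrite vnormZ cE mulVf.
by rewrite -scalemxAr vnormZ cE ler_pdivrMl// mulrC.
Qed.

Lemma cnorm_le_opnorm (p q : nat) (A : 'M[R[i]]_(p, q)) i j : cnorm (A i j) <= opnorm A.
Proof.
pose e : 'cV[R[i]]_q := delta_mx j 0.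
have e1 : vnorm e <= 1.
  rewrite -sqrtr1 ler_wsqrtr// (bigD1 j)//= big1 ?addr0 => [|k kj].
    by rewrite mxE !eqxx /= expr0n addr0 expr1n.
  by rewrite mxE (negPf kj) /= expr0n addr0.
have -> : A i j = (A *m e) i 0 by rewrite -colE mxE.
apply: le_trans (cnorm_le_vnorm _ _) _.
apply: le_trans (vnorm_mul_opnorm _ _) _.
rewrite -[leRHS]mulr1 ler_wpM2l//.
have := vnorm_mul_opnorm A e.
have ve : vnorm e != 0.
  apply/eqP => /vnorm_eq0 /matrixP /(_ j 0); rewrite !mxE !eqxx /= => /eqP.
  by rewrite oner_eq0.
have vp : 0 < vnorm e by rewrite lt_def ve vnorm_ge0.
by move=> h; have := le_trans (vnorm_ge0 _) h; rewrite pmulr_lge0.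
Qed.

End VectorNorm.

(** * Variational characterisation of the largest singular value *)

Section LargestSingularValue.
Variable R : realType.

Lemma adjmxM (p q r : nat) (A : 'M[R[i]]_(p, q)) (B : 'M[R[i]]_(q, r)) :
  adjmx (A *m B) = adjmx B *m adjmx A.
Proof. by rewrite /adjmx trmx_mul map_mxM. Qed.

Lemma adjmxK (p q : nat) (A : 'M[R[i]]_(p, q)) : adjmx (adjmx A) = A.
Proof. by apply/matrixP => i j; rewrite !mxE conjcK. Qed.

Lemma adjmx_mul_self (p : nat) (x : 'cV[R[i]]_p) :
  (adjmx x *m x) 0 0 = toC (vnorm x ^+ 2).
Proof.
rewrite mxE sqr_sqrtr; last by apply: sumr_ge0 => i _; rewrite addr_ge0 ?sqr_ge0.
apply/eqP; rewrite eq_complex; apply/andP; split; apply/eqP.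
  rewrite -[LHS]/(cre _) cre_sum /=; apply: eq_bigr => i _; rewrite !mxE.
  by case: (x i 0) => a b /=; rewrite mulNr opprK !expr2.
rewrite -[LHS]/(cim _) cim_sum /=; apply: big1 => i _; rewrite !mxE.
by case: (x i 0) => a b /=; rewrite mulNr mulrC subrr.
Qed.

Lemma vnorm_mul_sqr (p q : nat) (A : 'M[R[i]]_(p, q)) x :
  toC (vnorm (A *m x) ^+ 2) = (adjmx x *m (adjmx A *m A) *m x) 0 0.
Proof. by rewrite -adjmx_mul_self adjmxM !mulmxA. Qed.

(** [eigenvalue] speaks of row eigenvectors, so the column vector [x] is the adjoint of such a
    row. *)
Lemma vnorm_eigenvector (p q : nat) (A : 'M[R[i]]_(p, q)) a :
  eigenvalue (adjmx A *m A) a ->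
  exists2 x, vnorm x != 0 & vnorm (A *m x) ^+ 2 = cre a * vnorm x ^+ 2.
Proof.
move=> /eigenvalueP[v va v0]; exists (adjmx v).
  apply: contra v0 => /eqP/vnorm_eq0 v0.
  by rewrite -[v]adjmxK v0; apply/eqP/matrixP => i j; rewrite !mxE conjc0.
have := vnorm_mul_sqr A (adjmx v); rewrite adjmxK va -scalemxAl mxE.
have := adjmx_mul_self (adjmx v); rewrite adjmxK => -> /(congr1 (@cre R)) /= ->.
by case: a {va} => a b /=; rewrite mulr0 subr0.
Qed.

Lemma sqrt_eigenvalue_le (p q : nat) (A : 'M[R[i]]_(p, q)) a (c : R) :
  (forall x, vnorm (A *m x) <= c * vnorm x) -> eigenvalue (adjmx A *m A) a ->
  Num.sqrt (cre a) <= c.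
Proof.
move=> Ac /vnorm_eigenvector[x x0 xa].
have xgt0 : 0 < vnorm x by rewrite lt_def x0 vnorm_ge0.
have : Num.sqrt (vnorm (A *m x) ^+ 2) = Num.sqrt (cre a) * vnorm x.
  by rewrite xa mulrC sqrtrM ?sqr_ge0// sqrtr_sqr ger0_norm ?vnorm_ge0// mulrC.
rewrite sqrtr_sqr ger0_norm ?vnorm_ge0// => h.
by rewrite -(ler_pM2r xgt0) -h.
Qed.

Lemma sigma_max_has_ubound (p q : nat) (A : 'M[R[i]]_(p, q)) :
  has_ubound [set s : R | exists a : R[i],
    eigenvalue (adjmx A *m A) a /\ s = Num.sqrt (cre a)].
Proof.
exists (opnorm A) => _ [a [ea ->]].
by apply: sqrt_eigenvalue_le ea => x; exact: vnorm_mul_opnorm.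
Qed.

(** The spectral theorem for the Hermitian matrix [adjmx A *m A]; the rows of the unitary [P] are
    the row eigenvectors. *)
Lemma spectral_decomp (p q : nat) (A : 'M[R[i]]_(p, q)) :
  exists (P : 'M[R[i]]_q) (d : 'rV[R[i]]_q),
    [/\ adjmx P *m P = 1%:M, P *m (adjmx A *m A) = diag_mx d *m P &
        forall i, eigenvalue (adjmx A *m A) (d 0 i)].
Proof.
set H := adjmx A *m A.
have Hn : H \is normalmx.
  apply/normalmxP; rewrite -[map_mx _ _]/(adjmx H).
  by rewrite /H adjmxM adjmxK.
pose P := spectralmx H; pose d := spectral_diag H.
have Pu : P \in unitmx by exact: spectral_unit.
have PH : P *m H = diag_mx d *m P.
  by have /orthomx_spectralP e := Hn; rewrite {1}e !mulmxA mulmxV// mul1mx.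
have PP : adjmx P *m P = 1%:M.
  by have := mulVmx Pu; rewrite invmx_unitary ?spectral_unitarymx.
exists P, d; split => //.
move=> i; apply/eigenvalueP; exists (row i P).
  rewrite -row_mul PH; apply/rowP => j; rewrite !mxE (bigD1 i)//= !mxE eqxx.
  by rewrite big1 ?addr0// => k ki; rewrite mxE eq_sym (negPf ki) mul0r.
apply/eqP => /(congr1 (mulmx^~ (invmx P))) /=.
rewrite -row_mul mulmxV// mul0mx => /rowP /(_ i); rewrite !mxE eqxx => /eqP.
by rewrite oner_eq0.
Qed.

(** In the coordinates [y = P *m x], which keep the norm, the square of [vnorm (A *m x)] is the sum
    of the eigenvalues times the squared moduli of the [y i]. *)
Lemma vnorm_mul_sigma_max (p q : nat) (A : 'M[R[i]]_(p, q)) x :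
  vnorm (A *m x) <= sigma_max A * vnorm x.
Proof.
have [P [d [PP PH dH]]] := spectral_decomp A.
have de i : Num.sqrt (cre (d 0 i)) <= sigma_max A.
  apply: ub_le_sup; first exact: sigma_max_has_ubound.
  by exists (d 0 i); split.
(* An eigenvalue witnessing the sign of [sigma_max A] exists only if there is a column; otherwise
   [x] is the empty vector. *)
have q0 : x = 0 \/ 0 <= sigma_max A.
  have [i _|i0] := pickP 'I_q; first by right; exact: le_trans (sqrtr_ge0 _) (de i).
  by left; apply/matrixP => i j; have := i0 i.
have [->|s0] := q0; first by rewrite mulmx0 !vnorm0 mulr0.
have := vnorm_mul_sqr A x; set y := P *m x.
have -> : adjmx x *m (adjmx A *m A) *m x = adjmx y *m diag_mx d *m y.
  rewrite /y adjmxM -!mulmxA; congr (_ *m _); rewrite [diag_mx _ *m _]mulmxA -PH.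
  by rewrite !mulmxA PP mul1mx.
move/(congr1 (@cre R)) => /= e.
have yx : vnorm y = vnorm x.
  apply/eqP; rewrite -(eqrXn2 (n := 2))// ?vnorm_ge0//; apply/eqP.
  have /(congr1 (@cre R)) := vnorm_mul_sqr P x.
  by rewrite PP mulmx1 adjmx_mul_self.
clearbody y.
rewrite -(ler_pXn2r (n := 2))// ?nnegrE ?mulr_ge0 ?vnorm_ge0// e.
rewrite -yx exprMn vnormE l2_sqr mulr_sumr mxE cre_sum; apply: ler_sum => i _.
rewrite mul_mx_diag !mxE.
have -> : cre (conjc (y i 0) * d 0 i * y i 0) = cre (d 0 i) * cnorm (y i 0) ^+ 2.
  rewrite cnorm_sqr; case: (y i 0) => a b; case: (d 0 i) => f g /=; ring.
apply: ler_wpM2r; first exact: sqr_ge0.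
have [dn|dp] := leP (cre (d 0 i)) 0; first exact: le_trans dn (sqr_ge0 _).
by rewrite -[leLHS]sqr_sqrtr ?(ltW dp)// lerXn2r// nnegrE ?sqrtr_ge0.
Qed.

(** A positive [q] provides an eigenvalue; for [q = 0] the supremum of the empty set is 0 and a
    negative [c] would satisfy the premise. *)
Lemma sigma_max_le (p q : nat) (A : 'M[R[i]]_(p, q)) (c : R) : (0 < q)%N ->
  (forall x, vnorm (A *m x) <= c * vnorm x) -> sigma_max A <= c.
Proof.
move=> q0 Ac; apply: ge_sup => [|_ [a [ea ->]]]; last exact: sqrt_eigenvalue_le ea.
have [P [d [_ _ dH]]] := spectral_decomp A; pose i := Ordinal q0.
by exists (Num.sqrt (cre (d 0 i))), (d 0 i); split.
Qed.

(** [A] and [A'] may have different numbers of rows: this is what allows truncations of different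
    sizes, and the two resolvents, to be compared. *)
Lemma sigma_max_dist (p p' q : nat) (A : 'M[R[i]]_(p, q)) (A' : 'M[R[i]]_(p', q)) (e : R) :
  (0 < q)%N -> (forall x, `|vnorm (A *m x) - vnorm (A' *m x)| <= e * vnorm x) ->
  `|sigma_max A - sigma_max A'| <= e.
Proof.
move=> q0 h.
have key p1 p2 (A1 : 'M[R[i]]_(p1, q)) (A2 : 'M[R[i]]_(p2, q)) :
    (forall x, vnorm (A1 *m x) <= vnorm (A2 *m x) + e * vnorm x) ->
    sigma_max A1 <= sigma_max A2 + e.
  move=> A12; apply: sigma_max_le => // x; rewrite mulrDl.
  by apply: le_trans (A12 x) _; rewrite lerD2r vnorm_mul_sigma_max.
have h1 : sigma_max A <= sigma_max A' + e.
  by apply: key => x; have := h x; rewrite ler_norml => /andP[_]; rewrite lerBlDl.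
have h2 : sigma_max A' <= sigma_max A + e.
  apply: key => x; have := h x; rewrite distrC ler_norml => /andP[_].
  by rewrite lerBlDl.
by rewrite ler_norml lerBlDl h1 lerNl opprB lerBlDl h2.
Qed.

End LargestSingularValue.

(** * Exponential weights on the integers and their sums *)

Section ExponentialDecay.
Variable R : realType.

(** Also used at a negative rate, as the growing weight in [HR_solution_decay]. *)
Definition edecay (a : R) (k : int) : R := expR (- a * `|k%:~R : R|).

(** One geometric series for each sign, with 0 counted twice: a bound for the sum of [edecay a] over
    all integers. *)
Definition gsum (a : R) : R := (1 - expR (- a))^-1 *+ 2.

Lemma edecay_gt0 a k : 0 < edecay a k.
Proof. exact: expR_gt0. Qed.

Lemma edecay_ge0 a k : 0 <= edecay a k.
Proof. exact: expR_ge0. Qed.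

Lemma edecayD a b k : edecay (a + b) k = edecay a k * edecay b k.
Proof. by rewrite /edecay -expRD opprD mulrDl. Qed.

Lemma le_edecay a b k : a <= b -> edecay b k <= edecay a k.
Proof. by move=> ab; rewrite ler_expR ler_wpM2r// lerN2. Qed.

Lemma edecayN a k : edecay a (- k) = edecay a k.
Proof. by rewrite /edecay rmorphN normrN. Qed.

Lemma edecay_triangle a k l : 0 <= a -> edecay a (k - l) * edecay a l <= edecay a k.
Proof.
move=> a0; rewrite /edecay -expRD ler_expR -mulrDr ler_wnM2l ?oppr_le0//.
by rewrite rmorphB /=; apply: le_trans (ler_normD _ _); rewrite subrK.
Qed.

Lemma edecay_far a (d : nat) k : 0 <= a -> (d <= `|k|)%N -> edecay a k <= expR (- a * d%:R).
Proof.
move=> a0 dk; rewrite ler_expR ler_wnM2l ?oppr_le0//.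
by rewrite -[`|k%:~R|]intr_norm -natr_absz ler_nat.
Qed.

Lemma gsum_gt0 a : 0 < a -> 0 < gsum a.
Proof. by move=> a0; rewrite pmulrn_rgt0// invr_gt0 subr_gt0 expR_lt1 oppr_lt0. Qed.

Lemma sum_expr_uniq (r : R) (t : seq nat) : 0 <= r -> r < 1 -> uniq t ->
  \sum_(j <- t) r ^+ j <= (1 - r)^-1.
Proof.
move=> r0 r1 ut; pose Q := (\max_(j <- t) j).+1.
have -> : \sum_(j <- t) r ^+ j = \sum_(j <- iota 0 Q | j \in t) r ^+ j.
  rewrite -[RHS]big_filter; apply: perm_big; apply: uniq_perm => //.
    by rewrite filter_uniq// iota_uniq.
  move=> j; rewrite mem_filter mem_iota /= add0n /Q ltnS; case: (boolP (j \in t)) => //=.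
  by move=> jt; rewrite (big_rem j)//= leq_maxl.
apply: (@le_trans _ _ (\sum_(j < Q) r ^+ j)).
  rewrite -(big_mkord xpredT (fun j => r ^+ j)) /index_iota subn0.
  rewrite [leRHS](bigID (mem t)) /= lerDl; apply: sumr_ge0 => j _; exact: exprn_ge0.
have r1' : 0 < 1 - r by rewrite subr_gt0.
rewrite -(ler_pM2l r1') divff ?gt_eqF// -opprB mulNr -subrX1 opprB lerBlDr lerDl.
exact: exprn_ge0.
Qed.

Lemma sum_edecay_seq a (s : seq int) : 0 < a -> uniq s ->
  \sum_(k <- s) edecay a k <= gsum a.
Proof.
move=> a0 us; rewrite (bigID (fun k : int => 0 <= k)) /= /gsum mulr2n.
have r1 : expR (- a) < 1 by rewrite expR_lt1 oppr_lt0.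
(* Within one sign, [absz] is injective, so the exponents are distinct natural numbers. *)
have h (P : pred int) : (forall k l, P k -> P l -> absz k = absz l -> k = l) ->
    \sum_(k <- s | P k) edecay a k <= (1 - expR (- a))^-1.
  move=> Pi; rewrite -big_filter.
  have -> : \sum_(k <- [seq k <- s | P k]) edecay a k =
      \sum_(j <- [seq absz k | k <- [seq k <- s | P k]]) expR (- a) ^+ j.
    rewrite big_map; apply: eq_bigr => k _.
    by rewrite /edecay -expRM_natr -[`|k%:~R|]intr_norm -natr_absz.
  apply: sum_expr_uniq; [exact: expR_ge0|exact: r1|].
  rewrite map_inj_in_uniq ?filter_uniq// => k l; rewrite !mem_filter.
  by move=> /andP[Pk _] /andP[Pl _]; exact: Pi.
by apply: lerD; apply: h => k l; lia.
Qed.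

Lemma sum_edecay (I : finType) (h : I -> int) a : 0 < a -> injective h ->
  \sum_i edecay a (h i) <= gsum a.
Proof.
move=> a0 hi; rewrite -(big_enum _ _ xpredT (fun i => edecay a (h i))) /=.
rewrite -(big_map h xpredT (edecay a)); apply: sum_edecay_seq => //.
by rewrite map_inj_uniq// enum_uniq.
Qed.

(** Half of the rate pays for the distance [d], the other half keeps the sum finite. *)
Lemma sum_edecay_tail a (d : nat) (s : seq int) (P : pred int) : 0 < a -> uniq s ->
  (forall k, P k -> (d <= `|k|)%N) ->
  \sum_(k <- s | P k) edecay a k <= gsum (a / 2) * expR (- (a / 2) * d%:R).
Proof.
move=> a0 us Pd; have a20 : 0 < a / 2 by rewrite divr_gt0.
apply: (@le_trans _ _ (\sum_(k <- s | P k) edecay (a / 2) k * expR (- (a / 2) * d%:R))).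
  apply: ler_sum => k Pk; rewrite {1}[a]splitr edecayD ler_wpM2l ?edecay_ge0//.
  by rewrite edecay_far ?(ltW a20)// Pd.
rewrite -mulr_suml ler_wpM2r ?expR_ge0// -big_filter.
by apply: sum_edecay_seq => //; rewrite filter_uniq.
Qed.

End ExponentialDecay.

(** * The unit circle exponential *)

Section Expj.
Variable R : realType.
Implicit Types x y : R.

Lemma expjD x y : expj (x + y) = expj x * expj y.
Proof. by apply/eqP; rewrite eq_complex /= cosD sinD [sin x * _ + _]addrC !eqxx. Qed.

Lemma expj0 : expj (0 : R) = 1.
Proof. by rewrite /expj cos0 sin0. Qed.

Lemma expjNl x : expj (- x) * expj x = 1.
Proof. by rewrite -expjD addNr expj0. Qed.

Lemma expj_natM (n : nat) x : expj (n%:R * x) = expj x ^+ n.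
Proof.
elim: n => [|n ih]; first by rewrite mul0r expj0.
by rewrite exprS -ih -expjD -natr1 mulrDl mul1r addrC.
Qed.

Lemma expj_conj x : conjc (expj x) = expj (- x).
Proof. by rewrite /expj cosN sinN. Qed.

Lemma expj_2pi : expj (2 * pi : R) = 1.
Proof. by rewrite mulr_natl /expj cos2pi sin2pi. Qed.

Lemma expj_2pi_int (k : int) : expj (k%:~R * (2 * pi) : R) = 1.
Proof.
case: k => n; first by rewrite -pmulrn expj_natM expj_2pi expr1n.
rewrite NegzE rmorphN /= mulNr; apply: (mulIf (_ : expj (n.+1%:R * (2 * pi)) != 0)).
  by rewrite expj_natM expj_2pi expr1n oner_eq0.
by rewrite expjNl expj_natM expj_2pi expr1n mulr1.
Qed.

Lemma cnorm_expj_sub1 x : cnorm (expj x - 1) ^+ 2 = 2 - 2 * cos x.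
Proof.
rewrite cnorm_sqr /= oppr0 addr0; have := cos2Dsin2 x; nra.
Qed.

End Expj.

(** * Means over one period of real functions *)

Section Mean.
Variable R : realType.
Variable w0 : R.
Hypothesis w0_gt0 : 0 < w0.
Local Notation T := (period w0).
Local Notation mu := (@lebesgue_measure R).

Definition mean (g : R -> R) : R := T^-1 * Rintegral mu `[0, T] g.

Lemma period_gt0 : 0 < T.
Proof. by rewrite /period divr_gt0// mulr_gt0// pi_gt0. Qed.

Lemma continuous_integrable (g : R -> R) : continuous g ->
  mu.-integrable `[0, T] (EFin \o g).
Proof.
move=> cg; apply: continuous_compact_integrable; first exact: segment_compact.
exact: continuous_subspaceT.
Qed.

Lemma mean_le (g h : R -> R) : continuous g -> continuous h ->
  (forall t, 0 <= t <= T -> g t <= h t) -> mean g <= mean h.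
Proof.
move=> cg ch gh; rewrite ler_wpM2l ?invr_ge0 ?(ltW period_gt0)//.
by apply: le_Rintegral; rewrite ?continuous_integrable.
Qed.

Lemma meanD (g h : R -> R) : continuous g -> continuous h ->
  mean (fun t => g t + h t) = mean g + mean h.
Proof.
move=> cg ch; rewrite /mean RintegralD ?mulrDr//; exact: continuous_integrable.
Qed.

Lemma meanZ (c : R) (g : R -> R) : continuous g -> mean (fun t => c * g t) = c * mean g.
Proof.
move=> cg; rewrite /mean RintegralZl 1?mulrCA//; exact: continuous_integrable.
Qed.

Lemma mean_cst (c : R) : mean (fun=> c) = c.
Proof.
rewrite /mean Rintegral_cst//= lebesgue_measure_itv /= lte_fin period_gt0 /=.
by rewrite subr0 mulrC mulfK// gt_eqF// period_gt0.
Qed.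

Lemma mean_norm_le (g h : R -> R) : continuous g -> continuous h ->
  (forall t, 0 <= t <= T -> `|g t| <= h t) -> `|mean g| <= mean h.
Proof.
move=> cg ch gh; rewrite ler_norml; apply/andP; split.
  rewrite -mulN1r -meanZ//; apply: mean_le => //.
    by move=> t; apply: cvgM; [exact: cvg_cst|exact: ch].
  by move=> t /gh; rewrite ler_norml mulN1r => /andP[].
by apply: mean_le => // t /gh; rewrite ler_norml => /andP[].
Qed.

Lemma continuous_cosM (c d : R) : continuous (fun t => cos (c * t + d)).
Proof.
move=> t; apply: (@continuous_comp _ _ _ (fun t => c * t + d) cos).
  by apply: cvgD; [apply: cvgM; [exact: cvg_cst|exact: cvg_id]|exact: cvg_cst].
exact: continuous_cos.
Qed.

Lemma continuous_sinM (c d : R) : continuous (fun t => sin (c * t + d)).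
Proof.
move=> t; apply: (@continuous_comp _ _ _ (fun t => c * t + d) sin).
  by apply: cvgD; [apply: cvgM; [exact: cvg_cst|exact: cvg_id]|exact: cvg_cst].
exact: continuous_sin.
Qed.

Lemma mean_derive (F f : R -> R) : continuous f ->
  (forall t : R, is_derive t (1 : R) F (f t)) -> F T = F 0 -> mean f = 0.
Proof.
move=> cf dF FT; rewrite /mean /Rintegral (@continuous_FTC2 _ f F).
- by rewrite FT /= subrr mulr0.
- exact: period_gt0.
- exact: continuous_subspaceT.
- have cF t : {for t, continuous F}.
    by apply/differentiable_continuous/derivable1_diffP; have [] := dF t.
  split.
  + by move=> t _; have [] := dF t.
  + by apply: cvg_at_right_filter; exact: cF.
  + by apply: cvg_at_left_filter; exact: cF.
- by move=> t _; rewrite derive1E; have [_ ->] := dF t.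
Qed.

Lemma mean_cos (k : int) d : k != 0 -> mean (fun t => cos (k%:~R * w0 * t + d)) = 0.
Proof.
move=> k0; have kw : k%:~R * w0 != 0 by rewrite mulf_neq0 ?intr_eq0// gt_eqF.
apply: (@mean_derive (fun t => (k%:~R * w0)^-1 * sin (k%:~R * w0 * t + d))).
- exact: continuous_cosM.
- move=> t; apply: is_derive_eq.
  by rewrite /GRing.scale /= addr0 mulr1 mulrCA mulVf// mulr1.
- congr (_ * _); rewrite mulr0 add0r /period.
  have -> : k%:~R * w0 * (2 * pi / w0) + d = k%:~R * (2 * pi) + d.
    by field; rewrite gt_eqF.
  have := expjD (k%:~R * (2 * pi)) d; rewrite expj_2pi_int mul1r.
  by case.
Qed.

Lemma mean_sin (k : int) d : k != 0 -> mean (fun t => sin (k%:~R * w0 * t + d)) = 0.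
Proof.
move=> k0; rewrite -(mean_cos (d - pi / 2) k0); congr mean.
by apply/funext => t; rewrite addrA cosBpihalf.
Qed.

End Mean.

(** * Complex means, Fourier coefficients and orthogonality of harmonics *)

Section ComplexMean.
Variable R : realType.
Variable w0 : R.
Hypothesis w0_gt0 : 0 < w0.
Local Notation T := (period w0).

(** Continuity by real and imaginary parts, the form in which [cont_periodic] provides it. *)
Definition ccontinuous (f : R -> R[i]) : Prop :=
  continuous (fun t => cre (f t)) /\ continuous (fun t => cim (f t)).

Definition cmean (f : R -> R[i]) : R[i] :=
  Complex (mean w0 (fun t => cre (f t))) (mean w0 (fun t => cim (f t))).

(** The scalar counterpart of [fourier_coef], equal to its entries by unfolding. *)
Definition fcoef (f : R -> R[i]) (k : int) : R[i] :=
  cmean (fun t => f t * expj (- (k%:~R * w0 * t))).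

Lemma ccontinuous_cst (z : R[i]) : ccontinuous (fun=> z).
Proof. by split => t; exact: cvg_cst. Qed.

Lemma ccontinuousD (f g : R -> R[i]) : ccontinuous f -> ccontinuous g ->
  ccontinuous (fun t => f t + g t).
Proof.
move=> [f1 f2] [g1 g2]; split.
  by under eq_fun do rewrite creD; move=> t; apply: cvgD; [exact: f1|exact: g1].
by under eq_fun do rewrite cimD; move=> t; apply: cvgD; [exact: f2|exact: g2].
Qed.

Lemma ccontinuousM (f g : R -> R[i]) : ccontinuous f -> ccontinuous g ->
  ccontinuous (fun t => f t * g t).
Proof.
move=> [f1 f2] [g1 g2]; split.
  under eq_fun do rewrite creM; move=> t.
  by apply: cvgB; apply: cvgM; [exact: f1|exact: g1|exact: f2|exact: g2].
under eq_fun do rewrite cimM; move=> t.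
by apply: cvgD; apply: cvgM; [exact: f1|exact: g2|exact: f2|exact: g1].
Qed.

Lemma ccontinuous_sum (I : Type) (r : seq I) (F : I -> R -> R[i]) :
  (forall i, ccontinuous (F i)) -> ccontinuous (fun t => \sum_(i <- r) F i t).
Proof.
move=> cF; elim: r => [|i r ih].
  by under eq_fun do rewrite big_nil; exact: ccontinuous_cst.
by under eq_fun do rewrite big_cons; exact: ccontinuousD.
Qed.

Lemma ccontinuous_expj (c d : R) : ccontinuous (fun t => expj (c * t + d)).
Proof. by split; [exact: continuous_cosM|exact: continuous_sinM]. Qed.

Lemma cmeanD (f g : R -> R[i]) : ccontinuous f -> ccontinuous g ->
  cmean (fun t => f t + g t) = cmean f + cmean g.
Proof.
move=> [f1 f2] [g1 g2]; rewrite /cmean.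
by under eq_fun do rewrite creD; under [in X in Complex _ X]eq_fun do rewrite cimD; rewrite !meanD.
Qed.

Lemma cmeanZ (c : R[i]) (f : R -> R[i]) : ccontinuous f ->
  cmean (fun t => c * f t) = c * cmean f.
Proof.
move=> [f1 f2]; rewrite /cmean.
have cM (d : R) g : continuous g -> continuous (fun t : R => d * g t).
  by move=> cg t; apply: cvgM; [exact: cvg_cst|exact: cg].
have e1 : (fun t => cre (c * f t)) = (fun t => cre c * cre (f t) + (- cim c) * cim (f t)).
  by apply/funext => t; rewrite creM mulNr.
have e2 : (fun t => cim (c * f t)) = (fun t => cre c * cim (f t) + cim c * cre (f t)).
  by apply/funext => t; rewrite cimM.
rewrite e1 e2 !meanD ?meanZ//; try exact: cM.
by case: c {e1 e2} => a b /=; rewrite mulNr.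
Qed.

Lemma cmean_sum (I : Type) (r : seq I) (F : I -> R -> R[i]) :
  (forall i, ccontinuous (F i)) ->
  cmean (fun t => \sum_(i <- r) F i t) = \sum_(i <- r) cmean (F i).
Proof.
move=> cF; elim: r => [|i r ih].
  under eq_fun do rewrite big_nil.
  by rewrite big_nil /cmean /= !mean_cst.
under eq_fun do rewrite big_cons.
by rewrite big_cons cmeanD ?ih//; exact: ccontinuous_sum.
Qed.

Lemma cmean_expj (k : int) d :
  cmean (fun t => expj (k%:~R * w0 * t + d)) = if k == 0 then expj d else 0.
Proof.
rewrite /cmean /=; have [->|k0] := eqVneq k 0; last by rewrite mean_cos// mean_sin.
under eq_fun do rewrite !mul0r add0r.
under [in X in Complex _ X]eq_fun do rewrite !mul0r add0r.
by rewrite !mean_cst.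
Qed.

End ComplexMean.

(** * The Fejer kernel as an approximate identity *)

Section Fejer.
Variable R : realType.
Variable w0 : R.
Hypothesis w0_gt0 : 0 < w0.
Local Notation T := (period w0).

(** The squared modulus makes positivity immediate; [fejerE] recovers the trigonometric polynomial
    that produces Fourier coefficients. *)
Definition fejer (K : nat) (x : R) : R :=
  K%:R^-1 * cnorm (\sum_(k < K) expj (k%:R * x)) ^+ 2.

Lemma fejer_ge0 K x : 0 <= fejer K x.
Proof. by rewrite mulr_ge0 ?invr_ge0 ?sqr_ge0. Qed.

Lemma toC_cnorm_sqr (z : R[i]) : toC (cnorm z ^+ 2) = z * conjc z.
Proof.
rewrite cnorm_sqr; case: z => a b; apply/eqP; rewrite eq_complex /=.
by rewrite mulrN opprK !expr2 eqxx /= mulrN mulrC addNr.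
Qed.

Lemma fejerE K x : toC (fejer K x) =
  toC K%:R^-1 * \sum_(k < K) \sum_(l < K) expj ((l%:Z - k%:Z)%:~R * x).
Proof.
rewrite toCM toC_cnorm_sqr; congr (_ * _); rewrite mulrC rmorph_sum big_distrlr.
apply: eq_bigr => k _; apply: eq_bigr => l _.
rewrite -[LHS]/(conjc (expj (k%:R * x)) * expj (l%:R * x)) expj_conj -expjD.
congr expj.
by rewrite rmorphB /= mulrBl addrC.
Qed.

(* The geometric sum [E] of [expj (k x)] satisfies [(expj x - 1) E = expj (K x) - 1]. *)
Lemma fejer_le K x : (0 < K)%N -> (2 - 2 * cos x) * fejer K x <= 4 / K%:R.
Proof.
move=> K0; have Kp : 0 < K%:R :> R by rewrite ltr0n.
rewrite /fejer mulrCA mulrC ler_pM2r ?invr_gt0// -cnorm_expj_sub1 -exprMn -cnormM.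
under eq_bigr do rewrite expj_natM.
rewrite -subrX1 -expj_natM cnorm_expj_sub1.
by have := cos_geN1 (K%:R * x); lra.
Qed.

Lemma ccontinuous_fejer_sum K t0 : ccontinuous (fun t =>
  \sum_(k < K) \sum_(l < K) expj ((l%:Z - k%:Z)%:~R * (w0 * (t0 - t)))).
Proof.
apply: ccontinuous_sum => k; apply: ccontinuous_sum => l.
have -> : (fun t => expj ((l%:Z - k%:Z)%:~R * (w0 * (t0 - t)))) =
  (fun t => expj (- ((l%:Z - k%:Z)%:~R * w0) * t + (l%:Z - k%:Z)%:~R * w0 * t0)).
  by apply/funext => t; congr expj; ring.
exact: ccontinuous_expj.
Qed.

Lemma ccontinuous_fejer K t0 : ccontinuous (fun t => toC (fejer K (w0 * (t0 - t)))).
Proof.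
under eq_fun do rewrite fejerE.
by apply: ccontinuousM; [exact: ccontinuous_cst|exact: ccontinuous_fejer_sum].
Qed.

Lemma continuous_fejer K t0 : continuous (fun t => fejer K (w0 * (t0 - t))).
Proof. by have [] := ccontinuous_fejer K t0. Qed.

(** The right-hand side is the Cesaro mean of the Fourier series, left uncollected: harmonic [m]
    occurs [K - |m|] times. *)
Lemma cmean_fejer (f : R -> R[i]) K t0 : ccontinuous f ->
  cmean w0 (fun t => f t * toC (fejer K (w0 * (t0 - t)))) =
  toC K%:R^-1 * \sum_(k < K) \sum_(l < K)
     fcoef w0 f (l%:Z - k%:Z) * expj ((l%:Z - k%:Z)%:~R * w0 * t0).
Proof.
move=> cf; under eq_fun do rewrite fejerE mulrCA.
have cfe (c d : R) : ccontinuous (fun t => f t * expj (c * t + d)).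
  by apply: ccontinuousM => //; exact: ccontinuous_expj.
have eE k l t : f t * expj ((l%:Z - k%:Z)%:~R * (w0 * (t0 - t))) =
    f t * expj (- ((l%:Z - k%:Z)%:~R * w0) * t + (l%:Z - k%:Z)%:~R * w0 * t0).
  by congr (_ * expj _); ring.
have cs (k l : int) : ccontinuous (fun t => f t * expj ((l - k)%:~R * (w0 * (t0 - t)))).
  have -> : (fun t => f t * expj ((l - k)%:~R * (w0 * (t0 - t)))) =
     (fun t => f t * expj (- ((l - k)%:~R * w0) * t + (l - k)%:~R * w0 * t0)).
    by apply/funext => t; congr (_ * expj _); ring.
  exact: cfe.
rewrite cmeanZ; last first.
  apply: ccontinuousM => //; exact: ccontinuous_fejer_sum.
congr (_ * _); under eq_fun do rewrite mulr_sumr.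
rewrite (cmean_sum w0_gt0) => [|k]; last first.
  by under eq_fun do rewrite mulr_sumr; exact: ccontinuous_sum.
apply: eq_bigr => k _; under eq_fun do rewrite mulr_sumr.
rewrite (cmean_sum w0_gt0) => [|l]; last exact: cs.
apply: eq_bigr => l _; rewrite /fcoef mulrC -cmeanZ.
  by congr cmean; apply/funext => t; rewrite eE expjD mulrA mulrC mulNr.
have -> : (fun t => f t * expj (- ((l%:Z - k%:Z)%:~R * w0 * t))) =
  (fun t => f t * expj (- ((l%:Z - k%:Z)%:~R * w0) * t + 0)).
  by apply/funext => t; rewrite addr0 mulNr.
exact: cfe.
Qed.

(** [cmean_fejer] for the constant 1, where only the [K] diagonal terms survive. *)
Lemma mean_fejer K t0 : (0 < K)%N -> mean w0 (fun t => fejer K (w0 * (t0 - t))) = 1.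
Proof.
move=> K0; have := cmean_fejer K t0 (ccontinuous_cst (1 : R[i])).
under eq_fun do rewrite mul1r.
move/(congr1 (@cre R)) => /= ->.
have fc (k l : 'I_K) : fcoef w0 (fun=> 1) (l%:Z - k%:Z) = (l == k)%:R.
  rewrite /fcoef; have -> : (fun t => 1 * expj (- ((l%:Z - k%:Z)%:~R * w0 * t))) =
      (fun t => expj ((k%:Z - l%:Z)%:~R * w0 * t + 0)).
    by apply/funext => t; rewrite mul1r; congr expj; ring.
  rewrite cmean_expj// subr_eq0 eqz_nat eq_sym expj0 -[l == k :> nat]/(l == k).
  by case: (l == k).
have -> : \sum_(k < K) \sum_(l < K) fcoef w0 (fun=> 1) (l%:Z - k%:Z) *
    expj ((l%:Z - k%:Z)%:~R * w0 * t0) = \sum_(k < K) 1.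
  apply: eq_bigr => k _; rewrite (bigD1 k)//= fc eqxx big1 ?addr0 => [|l lk].
    by rewrite subrr !mul0r expj0 mul1r.
  by rewrite fc (negPf lk) mul0r.
by rewrite sumr_const card_ord -toC_nat -toCM mulVf// pnatr_eq0 -lt0n.
Qed.

Lemma cos_eq1 (x : R) : 0 <= x <= 2 * pi -> cos x = 1 -> x = 0 \/ x = 2 * pi.
Proof.
move=> /andP[x0 x2] cx; have s0 : sin (x / 2) = 0.
  have := cosD (x / 2) (x / 2); rewrite -splitr cx -!expr2 => e.
  have := cos2Dsin2 (x / 2) => e2.
  by apply/eqP; rewrite -sqrf_eq0; apply/eqP; lra.
have [->|xn0] := eqVneq x 0; first by left.
right; apply/eqP; rewrite eq_le x2 /= leNgt; apply/negP => xlt.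
have xp : 0 < x by rewrite lt_def xn0.
have : 0 < sin (x / 2) by apply: sin_gt0_pi; apply/andP; split; lra.
by rewrite s0 ltxx.
Qed.

(** The period is split by the size of [v t = |u t - u t0|] instead of the distance to [t0]. Where
    [v] is below [e / 2], the unit mass of the kernel suffices; elsewhere [q] is bounded below, and
    [fejer_le] makes the kernel of order [1 / K]. *)
Lemma fejer_cvg (u : R -> R) (t0 e : R) : continuous u -> u T = u 0 ->
  0 <= t0 <= T -> 0 < e ->
  exists K0, forall K, (K0 <= K)%N -> (0 < K)%N ->
    `|mean w0 (fun t => u t * fejer K (w0 * (t0 - t))) - u t0| <= e.
Proof.
move=> cu uT /andP[t00 t0T] e0.
have T0 := period_gt0 w0_gt0.
pose v (t : R) : R := `|u t - u t0|.
have cv : continuous v.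
  by move=> t; apply: cvg_norm; apply: cvgB; [exact: cu|exact: cvg_cst].
have [tU _ hU] := EVT_max (ltW T0) (continuous_subspaceT cv).
pose q (t : R) : R := 2 - 2 * cos (w0 * (t0 - t)).
have cq : continuous q.
  have -> : q = fun t => 2 - 2 * cos (- w0 * t + w0 * t0).
    by apply/funext => t; rewrite /q; congr (2 - 2 * cos _); ring.
  move=> t; apply: cvgB; first exact: cvg_cst.
  by apply: cvgM; [exact: cvg_cst|exact: continuous_cosM].
(* [eta] is the minimum of [q] on the compact set where [v] is at least [e / 2]. *)
have [eta eta0 heta] : exists2 eta : R, 0 < eta &
    forall t : R, 0 <= t <= T -> e / 2 <= v t -> eta <= q t.
  pose A := `[0, T] `&` [set t | e / 2 <= v t].
  have cA : compact A.
    apply: (@subclosed_compact _ _ `[0, T]%classic).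
    - apply: closedI; first exact: itv_closed.
      exact: ((continuous_closedP v).1 cv [set x | e / 2 <= x] (@closed_ge R _)).
    - exact: segment_compact.
    - by move=> t [].
  have [A0|/set0P An0] := eqVneq A set0.
    exists 1 => // t tT vt; have : A t by split => //=; rewrite in_itv.
    by rewrite A0.
  have [c cAm hc] := compact_EVT_min An0 cA (continuous_subspaceT cq).
  exists (q c); last first.
    by move=> t tT vt; apply: hc; rewrite inE; split => //=; rewrite in_itv.
  rewrite inE in cAm; have [/=] := cAm; rewrite in_itv /= => /andP[c0 cT] vc.
  rewrite lt_def; apply/andP; split; last first.
    by rewrite /q; have := cos_le1 (w0 * (t0 - c)); lra.
  (* If [q c = 0], then [w0 * (t0 - c)] is 0 or a full turn: [c] is [t0], or the two are opposite
     ends of the period and [uT] applies. *)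
  apply/negP => /eqP qc; suff uc : u c = u t0.
    by move: vc; rewrite /v uc subrr normr0; lra.
  have := @cos_eq1 (`|w0 * (t0 - c)|).
  have w0n : `|w0| = w0 by rewrite ger0_norm// ltW.
  have Tw : w0 * T = 2 * pi by rewrite /period mulrC divfK// gt_eqF.
  rewrite cos_norm normrM w0n -Tw ler_pM2l// mulr_ge0 ?(ltW w0_gt0)//=.
  have d1 : `|t0 - c| <= T by rewrite ler_norml; apply/andP; split; lra.
  have cc : cos (w0 * (t0 - c)) = 1 by move: qc; rewrite /q; lra.
  move=> /(_ d1 cc) [/eqP|/(mulfI _)].
    rewrite mulf_eq0 gt_eqF//= normr_eq0 subr_eq0 => /eqP->//.
  rewrite gt_eqF// => /(_ isT) h.
  have [t0c|ct0] := leP c t0.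
    have [-> ->] : c = 0 /\ t0 = T by move: h; rewrite ger0_norm ?subr_ge0//; lra.
    by [].
  have [-> ->] : c = T /\ t0 = 0.
    by move: h; rewrite ltr0_norm ?subr_lt0//; lra.
  by [].
have vU t : 0 <= t <= T -> v t <= v tU by move=> tT; apply: hU; rewrite in_itv.
have vU0 : 0 <= v tU by exact: normr_ge0.
(* This makes the far contribution [v tU * 4 / eta / K] at most [e / 2]. *)
exists (Num.truncn ((v tU * 4 / eta * (2 / e)) : R)).+1 => K hK K0.
have Kp : 0 < K%:R :> R by rewrite ltr0n.
have cF := @continuous_fejer K t0.
have -> : mean w0 (fun t => u t * fejer K (w0 * (t0 - t))) - u t0 =
   mean w0 (fun t => (u t - u t0) * fejer K (w0 * (t0 - t))).
  rewrite -{1}[u t0]mulr1 -(mean_fejer t0 K0) -mulNr -meanZ// -meanD.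
  - by congr mean; apply/funext => t; rewrite mulrBl mulNr.
  - by move=> t; apply: cvgM; [exact: cu|exact: cF].
  - by move=> t; apply: cvgM; [exact: cvg_cst|exact: cF].
have le1 : `|mean w0 (fun t => (u t - u t0) * fejer K (w0 * (t0 - t)))| <=
    mean w0 (fun t => e / 2 * fejer K (w0 * (t0 - t)) + v tU * 4 / eta / K%:R).
  apply: mean_norm_le => //.
  - by move=> t; apply: cvgM; [apply: cvgB; [exact: cu|exact: cvg_cst]|exact: cF].
  - move=> t; apply: cvgD; last exact: cvg_cst.
    by apply: cvgM; [exact: cvg_cst|exact: cF].
  move=> t tT; rewrite normrM (ger0_norm (fejer_ge0 _ _)) -/(v t).
  have F0 := fejer_ge0 K (w0 * (t0 - t)).
  have [vt|vt] := ltP (v t) (e / 2).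
    apply: ler_wpDr; first by rewrite !divr_ge0 ?mulr_ge0 ?(ltW eta0) ?(ltW Kp).
    by rewrite ler_wpM2r// ltW.
  apply: ler_wpDl; first by rewrite mulr_ge0 ?divr_ge0 ?(ltW e0).
  have qt := heta _ tT vt.
  have Fle : fejer K (w0 * (t0 - t)) <= 4 / K%:R / eta.
    rewrite ler_pdivlMr// mulrC; apply: le_trans (fejer_le (w0 * (t0 - t)) K0).
    by rewrite ler_wpM2r.
  apply: (@le_trans _ _ (v tU * (4 / K%:R / eta))).
    by apply: ler_pM; [exact: normr_ge0|exact: F0|exact: vU|exact: Fle].
  by rewrite le_eqVlt; apply/orP; left; apply/eqP; field; rewrite !gt_eqF.
apply: le_trans le1 _; rewrite meanD//; last 2 first.
- by move=> t; apply: cvgM; [exact: cvg_cst|exact: cF].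
- by move=> t; exact: cvg_cst.
rewrite meanZ// mean_fejer// mulr1 mean_cst//.
suff : v tU * 4 / eta / K%:R <= e / 2 by lra.
rewrite ler_pdivrMr// -ler_pdivrMl ?divr_gt0// invf_div mulrC.
apply: ltW; apply: lt_le_trans (truncnS_gt _) _.
by rewrite ler_nat.
Qed.

End Fejer.

(** * Pointwise Fourier expansion with an exponential remainder *)

Section FourierSeries.
Variable R : realType.

(** Common terms cancel, and what is left on either side has [|k| >= d]. *)
Lemma cnorm_sum_diff (a : int -> R[i]) (C al : R) (s s' : seq int) (d : nat) :
  0 <= C -> 0 < al -> (forall k, cnorm (a k) <= C * edecay al k) ->
  uniq s -> uniq s' ->
  (forall k, (`|k| < d)%N -> k \in s) -> (forall k, (`|k| < d)%N -> k \in s') ->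
  cnorm (\sum_(k <- s) a k - \sum_(k <- s') a k) <=
    2 * C * gsum (al / 2) * expR (- (al / 2) * d%:R).
Proof.
move=> C0 al0 ha us us' ds ds'.
rewrite (bigID (mem s')) /= [X in _ - X](bigID (mem s)) /=.
have -> : \sum_(k <- s | k \in s') a k = \sum_(k <- s' | k \in s) a k.
  rewrite -[LHS]big_filter -[RHS]big_filter; apply: perm_big; apply: uniq_perm.
  - by rewrite filter_uniq.
  - by rewrite filter_uniq.
  - by move=> k; rewrite !mem_filter andbC.
rewrite opprD addrACA subrr add0r.
apply: le_trans (cnormD _ _) _; rewrite cnormN.
have tail (u u' : seq int) : uniq u -> (forall k, (`|k| < d)%N -> k \in u') ->
    cnorm (\sum_(k <- u | k \notin u') a k) <=
    C * (gsum (al / 2) * expR (- (al / 2) * d%:R)).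
  move=> uu du; apply: le_trans (cnorm_sum _ _ _) _.
  apply: (@le_trans _ _ (\sum_(k <- u | k \notin u') C * edecay al k)).
    by apply: ler_sum => k _; exact: ha.
  rewrite -mulr_sumr ler_wpM2l//; apply: sum_edecay_tail => // k.
  by apply: contraR; rewrite -ltnNge; exact: du.
have := tail _ _ us ds'; have := tail _ _ us' ds; lra.
Qed.

Lemma sum_ltn_le (K d : nat) : (\sum_(k < K) (k < d) <= d)%N.
Proof.
suff -> : (\sum_(k < K) (k < d))%N = minn K d by rewrite geq_minr.
by elim: K => [|K ih]; rewrite ?big_ord0 ?big_ord_recr /= ?ih; lia.
Qed.

(** The Cesaro mean averages the sums over the windows from [- k] to [K - 1 - k]. All windows but at
    most [2 * d] contain every [|m| < d], and those few cause the term in [d / K]. *)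
Lemma fejer_sum_partial (a : int -> R[i]) (C al : R) (s : seq int) (d K : nat) :
  0 <= C -> 0 < al -> (forall k, cnorm (a k) <= C * edecay al k) ->
  uniq s -> (forall k, (`|k| < d)%N -> k \in s) -> (0 < K)%N ->
  cnorm (toC K%:R^-1 * (\sum_(k < K) \sum_(l < K) a (l%:Z - k%:Z)) - \sum_(m <- s) a m) <=
    2 * C * gsum (al / 2) * (expR (- (al / 2) * d%:R) + 2 * d%:R / K%:R).
Proof.
move=> C0 al0 ha us ds K0; set D := 2 * C * gsum (al / 2).
have D0 : 0 <= D.
  apply: mulr_ge0; first exact: mulr_ge0.
  by apply/ltW/gsum_gt0; rewrite divr_gt0.
have Kp : 0 < K%:R :> R by rewrite ltr0n.
have KC : toC K%:R^-1 * K%:R = 1 :> R[i].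
  by rewrite -toC_nat -toCM mulVf ?gt_eqF.
set S := \sum_(m <- s) a m.
have -> : toC K%:R^-1 * (\sum_(k < K) \sum_(l < K) a (l%:Z - k%:Z)) - S =
    toC K%:R^-1 * \sum_(k < K) (\sum_(l < K) a (l%:Z - k%:Z) - S).
  rewrite sumrB sumr_const card_ord mulrBr; congr (_ - _).
  by rewrite -[S *+ K]mulr_natl mulrA KC mul1r.
rewrite cnormM cnorm_toC ger0_norm ?invr_ge0 ?(ltW Kp)// ler_pdivrMl//.
apply: le_trans (cnorm_sum _ _ _) _.
pose e := expR (- (al / 2) * d%:R).
have bk (k : 'I_K) : cnorm (\sum_(l < K) a (l%:Z - k%:Z) - S) <=
    D * (e + ((k < d)%N%:R + (rev_ord k < d)%N%:R)).
  pose sk := [seq l%:Z - k%:Z | l <- iota 0 K].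
  have -> : \sum_(l < K) a (l%:Z - k%:Z) = \sum_(m <- sk) a m.
    by rewrite big_map -(big_mkord xpredT (fun l => a (l%:Z - k%:Z))) /index_iota subn0.
  have usk : uniq sk.
    by rewrite map_inj_uniq ?iota_uniq// => l l' /addIr [].
  case: (boolP ((k < d) || (rev_ord k < d))%N) => [bad|].
    (* A bad window only allows the cutoff 0; the resulting bound [D] is covered by an indicator
       equal to 1. *)
    have := @cnorm_sum_diff a C al sk s 0 C0 al0 ha usk us.
    rewrite mulr0 expR0 => /(_ _ _)/le_trans; apply => //.
    rewrite ler_wpM2l//.
    have : 0 <= e by exact: expR_ge0.
    case/orP: bad => -> /=; [case: (_ < d)%N|case: (k < d)%N] => /=; lra.
  rewrite negb_or -!leqNgt => /andP[kd rd].
  have := @cnorm_sum_diff a C al sk s d C0 al0 ha usk us.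
  move=> /(_ _ ds)/le_trans; apply; last first.
    by rewrite ler_wpM2l// lerDl addr_ge0.
  move=> m md; apply/mapP; exists (absz (m + k%:Z)).
    by rewrite mem_iota /= add0n; move: rd => /=; lia.
  lia.
apply: (@le_trans _ _ (\sum_(k < K) D * (e + ((k < d)%N%:R + (rev_ord k < d)%N%:R)))).
  by apply: ler_sum => k _; exact: bk.
rewrite -mulr_sumr mulrCA ler_wpM2l// !big_split /= sumr_const card_ord.
rewrite mulrDr [K%:R * (_ / _)]mulrC divfK ?gt_eqF// -[e *+ K]mulr_natl lerD2l.
rewrite -[X in _ + X](reindex_inj rev_ord_inj (P := xpredT) (F := fun k : 'I_K => (k < d)%N%:R)).
have : \sum_(k < K) (k < d)%N%:R <= d%:R :> R by rewrite -natr_sum ler_nat sum_ltn_le.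
by rewrite /=; lra.
Qed.

Variable w0 : R.
Hypothesis w0_gt0 : 0 < w0.
Local Notation T := (period w0).

(** The Fejer mean [sg] is close to [f t] by [fejer_cvg] and close to the partial sum by the decay
    of the coefficients. Letting [K] grow leaves only the tail beyond [d]. *)
Lemma fourier_partial_sum (f : R -> R[i]) (C al : R) (s : seq int) (d : nat) t :
  ccontinuous f -> f T = f 0 -> 0 <= C -> 0 < al ->
  (forall k, cnorm (fcoef w0 f k) <= C * edecay al k) ->
  uniq s -> (forall k, (`|k| < d)%N -> k \in s) -> 0 <= t <= T ->
  cnorm (f t - \sum_(m <- s) fcoef w0 f m * expj (m%:~R * w0 * t)) <=
    2 * C * gsum (al / 2) * expR (- (al / 2) * d%:R).
Proof.
move=> cf fT C0 al0 hf us ds tT; set D := 2 * C * gsum (al / 2).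
have D0 : 0 <= D.
  apply: mulr_ge0; first exact: mulr_ge0.
  by apply/ltW/gsum_gt0; rewrite divr_gt0.
set S := \sum_(m <- s) _.
pose a m := fcoef w0 f m * expj (m%:~R * w0 * t).
have ha k : cnorm (a k) <= C * edecay al k by rewrite cnormM cnorm_expj mulr1.
have [c1 c2] := cf.
apply/ler_addgt0Pr => e e0.
have e30 : 0 < e / 3 by lra.
have [K1 h1] := fejer_cvg w0_gt0 c1 (congr1 (@cre R) fT) tT e30.
have [K2 h2] := fejer_cvg w0_gt0 c2 (congr1 (@cim R) fT) tT e30.
(* With [d] fixed, this [K] brings [D * (2 * d / K)] below [e / 3]. *)
pose K := maxn (maxn K1 K2) (Num.truncn ((2 * d%:R * D * (3 / e)) : R)).+1.
have K0 : (0 < K)%N by rewrite /K; lia.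
have Kp : 0 < K%:R :> R by rewrite ltr0n.
have {}h1 := h1 K (leq_trans (leq_maxl _ _) (leq_maxl _ _)) K0.
have {}h2 := h2 K (leq_trans (leq_maxr _ _) (leq_maxl _ _)) K0.
pose sg := cmean w0 (fun u => f u * toC (fejer K (w0 * (t - u)))).
have h3 : cnorm (f t - sg) <= e / 3 + e / 3.
  rewrite -cnormN opprB; apply: le_trans (cnorm_le_reim _) _.
  apply: lerD.
    have -> : cre (sg - f t) = mean w0 (fun u => cre (f u) * fejer K (w0 * (t - u))) - cre (f t).
      rewrite creD /sg /=; congr (_ + _); last by case: (f t).
      by congr mean; apply/funext => u; case: (f u) => x y /=; rewrite mulr0 subr0.
    exact: h1.
  have -> : cim (sg - f t) = mean w0 (fun u => cim (f u) * fejer K (w0 * (t - u))) - cim (f t).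
    rewrite cimD /sg /=; congr (_ + _); last by case: (f t).
    by congr mean; apply/funext => u; case: (f u) => x y /=; rewrite mulr0 add0r.
  exact: h2.
have h4 : cnorm (sg - S) <= D * (expR (- (al / 2) * d%:R) + 2 * d%:R / K%:R).
  by rewrite /sg cmean_fejer//; exact: (fejer_sum_partial C0 al0 ha us ds K0).
have h5 : D * (2 * d%:R / K%:R) <= e / 3.
  rewrite mulrA ler_pdivrMr// -ler_pdivrMl// invf_div [3 / e * _]mulrC [D * _]mulrC.
  apply: ltW; apply: lt_le_trans (truncnS_gt _) _.
  by rewrite ler_nat leq_maxr.
have -> : f t - S = (f t - sg) + (sg - S) by rewrite addrA subrK.
apply: le_trans (cnormD _ _) _.
by move: h3 h4 h5; rewrite mulrDr; lra.
Qed.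

End FourierSeries.

(** * Exactness of spectral differentiation and the discrete Parseval identity *)

Section SpectralDifferentiation.
Variable R : realType.

Definition gridpt (p i : nat) : R := 2 * pi * i%:R / p%:R.

Lemma expj_eq1 (x : R) : x != 0 -> `|x| < 2 * pi -> expj x != 1.
Proof.
move=> x0 x2; apply/eqP => -[cx _].
have := @cos_eq1 R `|x|; rewrite cos_norm normr_ge0 (ltW x2) => /(_ isT cx)[/eqP|e].
  by rewrite normr_eq0 (negPf x0).
by rewrite e ltxx in x2.
Qed.

Lemma sum_expj_gridpt (p : nat) (a : int) : a != 0 -> (`|a| < p)%N ->
  \sum_(q < p) expj (a%:~R * gridpt p q) = 0.
Proof.
move=> a0 ap; have p0 : (0 < p)%N by exact: leq_ltn_trans ap.
have pn0 : p%:R != 0 :> R by rewrite pnatr_eq0 -lt0n.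
pose z : R[i] := expj (a%:~R * (2 * pi) / p%:R).
have -> : \sum_(q < p) expj (a%:~R * gridpt p q) = \sum_(q < p) z ^+ q.
  apply: eq_bigr => q _; rewrite -expj_natM /gridpt; congr expj; field.
  by rewrite pn0.
have z1 : z - 1 != 0.
  rewrite subr_eq0; apply: expj_eq1.
    by rewrite !mulf_neq0 ?intr_eq0 ?invr_eq0// gt_eqF// pi_gt0.
  have pi0 := pi_gt0 R.
  have pi2 : 0 < 2 * pi :> R by rewrite mulr_gt0.
  have q0 : 0 <= 2 * pi / p%:R :> R by rewrite divr_ge0 ?ler0n ?(ltW pi2).
  rewrite -mulrA normrM (ger0_norm q0) mulrA ltr_pdivrMr ?ltr0n// mulrC ltr_pM2l//.
  by rewrite -intr_norm -natr_absz ltr_nat.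
apply: (mulfI z1); rewrite -subrX1 mulr0 -expj_natM.
have -> : p%:R * (a%:~R * (2 * pi) / p%:R) = a%:~R * (2 * pi) :> R.
  by field; rewrite pn0.
by rewrite expj_2pi_int subrr.
Qed.

Lemma toC_sign (d : int) : toC ((-1) ^ d) = expj (pi * d%:~R : R).
Proof.
have h n : toC ((-1) ^+ n) = expj (pi * n%:R : R).
  elim: n => [|n ih]; first by rewrite mulr0 expj0.
  rewrite exprS toCM ih -natr1 mulrDr mulr1 expjD mulrC; congr (_ * _).
  by rewrite /expj cospi sinpi.
case: d => n; first exact: h.
rewrite NegzE -exprnN -exprVn invrN1 h.
(* For a negative exponent the angle changes sign, that is, it moves by whole turns. *)
have -> : pi * (- n.+1%:Z)%:~R = pi * n.+1%:R + (- n.+1%:Z)%:~R * (2 * pi) :> R.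
  by rewrite rmorphN /= -pmulrn; ring.
by rewrite expjD expj_2pi_int mulr1.
Qed.

Section Differentiation.
Variables (N : nat).
Local Notation p := (2 * N + 1)%N.
Variable i : 'I_p.

Let delta (k : 'I_p) : R := gridpt p k - gridpt p i.

(** The eigenvalue of [Dspec] on harmonic [m], read off in row [i]. It is determined by its
    increments, all equal to [jC], and by its vanishing sum over [- N .. N]. *)
Let S (m : int) : R[i] := \sum_(k < p) toC (Dspec p i k) * expj (m%:~R * delta k).

Lemma sin_gridpt_neq0 (k : 'I_p) : k != i ->
  sin (pi * (i%:R - k%:R) / p%:R : R) != 0.
Proof.
move=> ki; have pi0 := pi_gt0 R; have pp : 0 < p%:R :> R by rewrite ltr0n addn1.
have h (a b : nat) : (b < a < p)%N -> 0 < sin (pi * (a%:R - b%:R) / p%:R : R).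
  move=> /andP[ba ap]; apply: sin_gt0_pi; rewrite -natrB ?(ltnW ba)//.
  apply/andP; split; first by rewrite divr_gt0// mulr_gt0// ltr0n subn_gt0.
  rewrite ltr_pdivrMr// ltr_pM2l// ltr_nat.
  by apply: leq_ltn_trans ap; exact: leq_subr.
have [ik|ik|/ord_inj e] := ltngtP k i; last by rewrite e eqxx in ki.
  by rewrite gt_eqF// h// ik ltn_ord.
rewrite -[i%:R - _]opprB mulrN mulNr sinN oppr_eq0 gt_eqF// h//.
by rewrite ik ltn_ord.
Qed.

(** Raising [m] by one produces the factor [expj (- y) - expj y], whose sine cancels the cosecant of
    [Dspec]. The alternating sign is the phase [expj (p * y)], and [p = 2 * N + 1] shifts the
    harmonic to [m - N]. *)
Lemma Dspec_step (k : 'I_p) (m : int) : k != i ->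
  toC (Dspec p i k) * expj ((m + 1)%:~R * delta k) -
  toC (Dspec p i k) * expj (m%:~R * delta k) = - (jC * expj ((m - N%:Z)%:~R * delta k)).
Proof.
move=> ki; have pn0 : p%:R != 0 :> R by rewrite pnatr_eq0 addn1.
have sn := sin_gridpt_neq0 ki; set y : R := pi * (i%:R - k%:R) / p%:R in sn.
have dE : delta k = - (y + y) by rewrite /delta /gridpt /y; field.
have e1 : expj ((m + 1)%:~R * delta k) = expj (- ((m + m + 1)%:~R * y)) * expj (- y).
  by rewrite -expjD dE; congr expj; rewrite !rmorphD /=; ring.
have e2 : expj (m%:~R * delta k) = expj (- ((m + m + 1)%:~R * y)) * expj y.
  by rewrite -expjD dE; congr expj; rewrite !rmorphD /=; ring.
have e3 : expj (- y) - expj y = - (toC (2 * sin y) * jC).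
  apply/eqP; rewrite eq_complex /= cosN sinN !mulr0 !mul0r !mulr1 !subr0 addr0 oppr0 subrr.
  by rewrite eqxx /=; apply/eqP; ring.
rewrite e1 e2 -mulrBr -mulrBr e3 !mulrN; congr (- _).
have -> : toC (Dspec p i k) = toC ((-1) ^ (i%:Z - k%:Z)) * toC (2 * sin y)^-1.
  rewrite -toCM mxE eq_sym (negPf ki); congr toC.
  by rewrite -/y invfM; ring.
have bb : toC (2 * sin y)^-1 * toC (2 * sin y) = 1.
  by rewrite -toCM mulVf// mulf_neq0.
set E := expj (- _); rewrite toC_sign.
have -> (a b b' : R[i]) : a * b' * (E * (b * jC)) = jC * (a * E) * (b' * b) by ring.
rewrite bb mulr1 /E -expjD; congr (_ * expj _); rewrite dE.
have -> : pi * (i%:Z - k%:Z)%:~R = p%:R * y :> R.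
  by rewrite rmorphB /= /y -!pmulrn; field.
have -> : p%:R = 2 * N%:R + 1 :> R by rewrite natrD natrM.
by rewrite rmorphB !rmorphD /= -!pmulrn; ring.
Qed.

Lemma S_step (m : int) : - N%:Z <= m -> m < N%:Z -> S (m + 1) - S m = jC.
Proof.
move=> m1 m2; rewrite /S -sumrB (bigD1 i)//= [Dspec p i i]mxE eqxx !mul0r subrr add0r.
rewrite (eq_bigr (fun k => - (jC * expj ((m - N%:Z)%:~R * delta k)))) => [|k ki]; last first.
  exact: Dspec_step.
rewrite sumrN -mulr_sumr.
(* Here [m - N] lies between [- 2 * N] and -1, so the full sum vanishes; without the term [k = i],
   which is 1, it equals -1. *)
have z0 : \sum_(k < p) expj ((m - N%:Z)%:~R * delta k) = 0.
  under eq_bigr => k _ do rewrite /delta mulrBr expjD.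
  by rewrite -mulr_suml sum_expj_gridpt ?mul0r//; lia.
move: z0; rewrite (bigD1 i)//= /delta subrr mulr0 expj0 => /eqP.
by rewrite addrC addr_eq0 => /eqP ->; rewrite mulrN mulr1 opprK.
Qed.

Lemma S_iter (q : nat) : (q <= 2 * N)%N -> S (q%:Z - N%:Z) = S (- N%:Z) + jC * q%:R.
Proof.
elim: q => [|q ih] qN; first by rewrite sub0r mulr0 addr0.
have := @S_step (q%:Z - N%:Z) _ _; rewrite ih; last by lia.
have -> : q%:Z - N%:Z + 1 = q.+1%:Z - N%:Z by lia.
move=> h; apply/eqP; rewrite -natr1 mulrDr mulr1 addrA [X in _ == X]addrC -subr_eq.
by apply/eqP; apply: h; lia.
Qed.

(** The diagonal of [Dspec] is zero, and for [k] other than [i] the harmonics [- N .. N] at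
    [delta k] sum to zero. *)
Lemma S_sum : \sum_(q < p) S (q%:Z - N%:Z) = 0.
Proof.
have pn0 : p%:R != 0 :> R by rewrite pnatr_eq0 addn1.
rewrite /S exchange_big /= big1// => k _; rewrite -mulr_sumr.
have [->|ki] := eqVneq k i; first by rewrite mxE eqxx mul0r.
under eq_bigr => q _.
  have -> : (q%:Z - N%:Z)%:~R * delta k =
      - (N%:R * delta k) + (k%:Z - i%:Z)%:~R * gridpt p q.
    by rewrite /delta /gridpt !rmorphB /= -!pmulrn; field.
  rewrite expjD; over.
rewrite -mulr_sumr sum_expj_gridpt ?mulr0//.
  by rewrite subr_eq0 eqz_nat.
have := ltn_ord k; have := ltn_ord i; lia.
Qed.

Lemma S_eq (m : int) : (`|m| <= N)%N -> S m = jC * m%:~R.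
Proof.
(* [S_iter] inserted in [S_sum] gives [p * (S (- N) + jC * N) = 0]. *)
move=> mN; have SN : S (- N%:Z) = - (jC * N%:R).
  have := S_sum; rewrite (eq_bigr (fun q : 'I_p => S (- N%:Z) + jC * q%:R)); last first.
    by move=> q _; apply: S_iter; have := ltn_ord q; lia.
  rewrite big_split /= sumr_const card_ord -mulr_sumr -natr_sum.
  have -> : (\sum_(q < p) q)%N = (N * p)%N.
    have aux n : (2 * \sum_(q < n) q = n * n.-1)%N.
      by elim: n => [|n ih]; rewrite ?big_ord0// big_ord_recr mulnDr ih /=; nia.
    by have := aux p; nia.
  rewrite natrM mulrA -[X in X + _]mulr_natr -mulrDl => /eqP.
  rewrite mulf_eq0 pnatr_eq0 addn1 orbF addr_eq0 => /eqP ->//.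
have := @S_iter (absz (m + N%:Z)) _; rewrite SN.
have -> : (absz (m + N%:Z))%:Z - N%:Z = m by lia.
move=> -> //; last by lia.
have -> : (absz (m + N%:Z))%:R = m%:~R + N%:R :> R[i].
  by rewrite natr_absz ger0_norm ?rmorphD//=; lia.
by rewrite mulrDr addrCA addNr addr0.
Qed.

Lemma Dspec_expj (m : int) : (`|m| <= N)%N ->
  \sum_(k < p) toC (Dspec p i k) * expj (m%:~R * gridpt p k) =
  jC * m%:~R * expj (m%:~R * gridpt p i).
Proof.
move=> mN; rewrite -(S_eq mN) /S mulr_suml; apply: eq_bigr => k _.
by rewrite -mulrA -expjD; congr (_ * expj _); rewrite /delta; ring.
Qed.

End Differentiation.

(** Expanding the squares, summation over the grid kills every pair [k != l]. Only differences of
    harmonics matter, so the shift [c] is free; it is [N] in the application. *)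
Lemma dft_isometry_scalar (p : nat) (c : int) (z : 'I_p -> R[i]) :
  \sum_(i < p) cnorm (\sum_(k < p) expj ((k%:Z - c)%:~R * gridpt p i) * z k) ^+ 2 =
  p%:R * \sum_(k < p) cnorm (z k) ^+ 2.
Proof.
suff : toC (\sum_(i < p) cnorm (\sum_(k < p) expj ((k%:Z - c)%:~R * gridpt p i) * z k) ^+ 2)
     = toC (p%:R * \sum_(k < p) cnorm (z k) ^+ 2) by case.
have sq (i : 'I_p) : toC (cnorm (\sum_(k < p) expj ((k%:Z - c)%:~R * gridpt p i) * z k) ^+ 2) =
    \sum_(k < p) \sum_(l < p) expj ((k%:Z - l%:Z)%:~R * gridpt p i) * (z k * conjc (z l)).
  rewrite toC_cnorm_sqr rmorph_sum big_distrlr.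
  apply: eq_bigr => k _; apply: eq_bigr => l _.
  rewrite -[LHS]/(expj ((k%:Z - c)%:~R * gridpt p i) * z k *
    conjc (expj ((l%:Z - c)%:~R * gridpt p i) * z l)).
  have -> (a b : R[i]) : conjc (a * b) = conjc a * conjc b by exact: rmorphM.
  rewrite mulrACA; congr (_ * _); rewrite expj_conj -expjD.
  by congr expj; rewrite !rmorphB /=; ring.
rewrite toCM !toC_sum; under eq_bigr do rewrite sq.
rewrite exchange_big mulr_sumr.
apply: eq_bigr => k _ /=; rewrite exchange_big (bigD1 k)//= [X in _ + X]big1 ?addr0 => [|l lk].
  under eq_bigr do rewrite subrr mul0r expj0 mul1r.
  by rewrite sumr_const card_ord -[LHS]mulr_natl toC_nat toC_cnorm_sqr.
rewrite -mulr_suml sum_expj_gridpt ?mul0r//.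
  by rewrite subr_eq0 eqz_nat eq_sym.
by have := ltn_ord k; have := ltn_ord l; lia.
Qed.

End SpectralDifferentiation.

(** * Sums over harmonic indices and the cost of the weight *)

Section HarmonicIndices.
Variable R : realType.

Lemma hidx_inj N : injective (@hidx N).
Proof. by move=> i j /addIr [] /ord_inj. Qed.

Lemma absz_hidx N (i : 'I_(2 * N + 1)) : (`|hidx i| <= N)%N.
Proof. by rewrite /hidx; have := ltn_ord i; lia. Qed.

Lemma hidx_ex N (k : int) : (`|k| <= N)%N -> exists i : 'I_(2 * N + 1), hidx i = k.
Proof.
move=> kN; have h : (absz (k + N%:Z)%R < 2 * N + 1)%N by lia.
by exists (Ordinal h); rewrite /hidx /=; lia.
Qed.

Lemma sum_hidx_widen (V : nmodType) (G : int -> V) (N N' : nat) : (N <= N')%N ->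
  (forall k, (N < `|k|)%N -> G k = 0) ->
  \sum_(l < 2 * N' + 1) G (hidx l) = \sum_(l < 2 * N + 1) G (hidx l).
Proof.
move=> NN' G0.
have E Q : \sum_(l < 2 * Q + 1) G (hidx l) = \sum_(0 <= l < 2 * Q + 1) G (l%:Z - Q%:Z).
  by rewrite big_mkord.
rewrite !{}E -(subnKC NN'); elim: (N' - N)%N => [|d ih]; first by rewrite addn0.
rewrite -{}ih (addnS N d); set Q := (N + d)%N.
have -> : (2 * Q.+1 + 1 = (2 * Q + 1).+2)%N by lia.
rewrite big_nat_recl// big_nat_recr//= !G0 ?add0r ?addr0; [|rewrite /Q; lia..].
by apply: eq_bigr => l _; congr G; lia.
Qed.

Lemma sum_edecay_hidx (a : R) N : 0 < a -> \sum_(i < 2 * N + 1) edecay a (hidx i) <= gsum a.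
Proof. by move=> a0; apply: sum_edecay => //; exact: hidx_inj. Qed.

Lemma sum_edecay_hidxB (a : R) N (k : int) : 0 < a ->
  \sum_(i < 2 * N + 1) edecay a (k - hidx i) <= gsum a.
Proof.
move=> a0; apply: (@sum_edecay R _ (fun i => k - hidx i)) => // i j.
by move=> /addrI/oppr_inj; exact: hidx_inj.
Qed.

(** One quarter of the rate [al] absorbs [expR (be * r)], another quarter the factor [r] coming from
    the mean value estimate. What matters is the factor [be] that remains, since it can be made
    small. *)
Lemma weight_bound (al be r s : R) : 0 < al -> 0 <= be -> be <= al / 4 -> 0 <= r ->
  `|s| <= be * r ->
  `|expR s - 1| * expR (- al * r) <= be * (4 / al) * expR (- (al / 2) * r).
Proof.
move=> al0 be0 bea r0 sr.
have h1 : `|expR s - 1| <= expR (be * r) - 1.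
  have e1 := expR_ge1Dx s; have e2 := expR_ge1Dx (be * r).
  have sr' := sr; move: sr'; rewrite ler_norml => /andP[s1 s2].
  have : expR s <= expR (be * r) by rewrite ler_expR.
  by rewrite ler_norml => e3; apply/andP; split; lra.
have h2 : expR (be * r) - 1 <= be * r * expR (be * r).
  have e1 := expR_ge1Dx (- (be * r)).
  have : (1 + - (be * r)) * expR (be * r) <= 1.
    by apply: le_trans (ler_wpM2r (expR_ge0 _) e1) _; rewrite -expRD addNr expR0.
  by rewrite mulrDl mul1r mulNr; lra.
have h3 : r <= 4 / al * expR (al / 4 * r).
  have e1 := expR_ge1Dx (al / 4 * r).
  have al40 : 0 < al / 4 by rewrite divr_gt0.
  rewrite -(ler_pM2l al40) mulrA; have -> : al / 4 * (4 / al) = 1 by field; rewrite gt_eqF.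
  by rewrite mul1r; lra.
apply: (@le_trans _ _ (be * r * expR (be * r) * expR (- al * r))).
  by rewrite ler_wpM2r ?expR_ge0//; exact: le_trans h2.
apply: (@le_trans _ _ (be * (4 / al * expR (al / 4 * r)) * expR (be * r) * expR (- al * r))).
  by rewrite !ler_wpM2r ?expR_ge0// ler_wpM2l.
rewrite !mulrA -!mulrA -!expRD !mulrA ler_wpM2l//; last first.
  by rewrite ler_expR -!mulrDl ler_wpM2r//; lra.
by rewrite !mulr_ge0// invr_ge0 ltW.
Qed.

End HarmonicIndices.

(** * Decay of harmonic-resolvent solutions *)

Section HarmonicResolvent.
Variables (R : realType) (n : nat) (w0 wf : R).
Local Notation "J ^[ k ]" := (fourier_coef w0 J k) (at level 2, format "J ^[ k ]").

Definition freq (k : int) : R[i] := jC * toC (wf + k%:~R * w0).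

Lemma L_HR_mul (J : R -> 'M[R[i]]_n) N (x : 'I_(2 * N + 1) -> 'cV[R[i]]_n) :
  L_HR w0 wf J N *m \mxcol_i x i =
  \mxcol_i (freq (hidx i) *: x i - \sum_l J^[hidx i - hidx l] *m x l).
Proof.
rewrite /L_HR mul_mxblock_mxrow; apply: eq_mxcol => i.
under eq_bigr do rewrite mulmxBl.
rewrite sumrB; congr (_ - _); rewrite (bigD1 i)//= eqxx mul_scalar_mx big1 ?addr0// => l li.
by rewrite eq_sym (negPf li) mul0mx.
Qed.

Lemma vnorm_invmx_le (q : nat) (L : 'M[R[i]]_q) (M : R) x :
  L \in unitmx -> opnorm (invmx L) <= M -> vnorm x <= M * vnorm (L *m x).
Proof.
move=> Lu LM; rewrite -{1}(mulKmx Lu x); apply: le_trans (vnorm_mul_opnorm _ _) _.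
by rewrite ler_wpM2r ?vnorm_ge0.
Qed.

Variables (C M al be : R).
Hypotheses (C_gt0 : 0 < C) (M_gt0 : 0 < M) (al_gt0 : 0 < al) (be_gt0 : 0 < be).
Hypothesis be_le : be <= al / 4.
Hypothesis be_small : M * (C * (be * (4 / al)) * gsum (al / 2)) <= 1 / 2.

Definition HR_solution (J : R -> 'M[R[i]]_n) N (b : 'cV[R[i]]_n)
    (x : 'I_(2 * N + 1) -> 'cV[R[i]]_n) : Prop :=
  forall i, freq (hidx i) *: x i - \sum_l J^[hidx i - hidx l] *m x l =
    if hidx i == 0 then b else 0.

(* The weighted vector [y i = exp (be * |i|) x i] solves a perturbation of the
   same equation whose size is controlled by [be] through the Schur test. *)
Lemma HR_solution_decay J N b x :
  (forall k v, vnorm (J^[k] *m v) <= C * edecay al k * vnorm v) ->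
  L_HR w0 wf J N \in unitmx -> opnorm (invmx (L_HR w0 wf J N)) <= M ->
  @HR_solution J N b x ->
  forall i, vnorm (x i) <= 2 * M * vnorm b * edecay be (hidx i).
Proof.
move=> hJ Lu LM hx.
pose e i := edecay (- be) (@hidx N i).
have eK i : edecay be (hidx i) * e i = 1.
  by rewrite -edecayD subrr /edecay oppr0 mul0r expR0.
have e0 i : 0 < e i by exact: edecay_gt0.
pose y i := toC (e i) *: x i.
have xE i : x i = toC (edecay be (hidx i)) *: y i.
  by rewrite scalerA -toCM eK scale1r.
pose s := C * (be * (4 / al)).
have s0 : 0 <= s by rewrite !mulr_ge0 ?invr_ge0 ?(ltW C_gt0) ?(ltW be_gt0) ?(ltW al_gt0).
have al20 : 0 < al / 2 by rewrite divr_gt0.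
have G0 := ltW (gsum_gt0 al20).
pose g (i l : 'I_(2 * N + 1)) := s * edecay (al / 2) (hidx i - hidx l).
have ylt : l2 (fun i => vnorm (y i)) <= M * (vnorm b + s * gsum (al / 2) * l2 (fun i => vnorm (y i))).
  rewrite -{1}vnorm_mxcol; apply: le_trans (vnorm_invmx_le _ Lu LM) _.
  rewrite ler_wpM2l ?(ltW M_gt0)// L_HR_mul vnorm_mxcol.
  apply: (@le_trans _ _ (l2 (fun i => (if hidx i == 0 then vnorm b else 0) +
     \sum_l g i l * vnorm (y l)))).
    apply: le_l2 => i; rewrite vnorm_ge0 /=.
    (* The diagonal frequencies commute with the weight; each coefficient block leaves the
       commutator factor [e i - e l]. *)
    have -> : freq (hidx i) *: y i - \sum_l J^[hidx i - hidx l] *m y l =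
      toC (e i) *: (if hidx i == 0 then b else 0) +
      \sum_l toC (e i - e l) *: (J^[hidx i - hidx l] *m x l).
      rewrite -(hx i) scalerBr scalerA mulrC -scalerA -/(y i) -addrA; congr (_ + _).
      rewrite scaler_sumr -sumrN -sumrN -big_split /=; apply: eq_bigr => l _.
      rewrite /y -scalemxAr -!scaleNr -scalerDl; congr (_ *: _).
      by apply/eqP; rewrite eq_complex /=; apply/andP; split; apply/eqP; ring.
    apply: le_trans (vnormD _ _) _; apply: lerD.
      rewrite vnormZ cnorm_toC gtr0_norm//; case: eqP => [h|_]; last by rewrite vnorm0 mulr0.
      by rewrite /e h /edecay normr0 mulr0 expR0 mul1r.
    apply: le_trans (vnorm_sum _ _ _) _; apply: ler_sum => l _.
    rewrite vnormZ cnorm_toC.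
    apply: le_trans (ler_wpM2l (normr_ge0 _) (hJ _ _)) _.
    rewrite {1}xE vnormZ cnorm_toC (gtr0_norm (edecay_gt0 _ _)).
    have -> : `|e i - e l| * (C * edecay al (hidx i - hidx l) * (edecay be (hidx l) * vnorm (y l))) =
       C * ((`|e i - e l| * edecay be (hidx l)) * edecay al (hidx i - hidx l)) * vnorm (y l) by ring.
    rewrite ler_wpM2r ?vnorm_ge0// /g /s -[leRHS]mulrA ler_wpM2l ?(ltW C_gt0)//.
    rewrite -[edecay be _]ger0_norm ?edecay_ge0// -normrM mulrBl [e l * _]mulrC eK.
    (* The exponent is [be] times a difference of moduli, at most [be] times the modulus of
       [hidx i - hidx l]. *)
    rewrite /e /edecay -expRD; apply: weight_bound => //; first exact: ltW.
    have -> : - - be * `|(hidx i)%:~R| + - be * `|(hidx l)%:~R| =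
      be * (`|(hidx i)%:~R| - `|(hidx l)%:~R|) :> R by ring.
    rewrite normrM gtr0_norm// ler_pM2l//.
    rewrite [(hidx i - hidx l)%:~R]rmorphB /=; exact: ler_dist_dist.
  apply: le_trans (l2D _ _) _; apply: lerD.
    apply: le_trans (l2_le_sum _) _ => [i|]; first by case: ifP => // _; exact: vnorm_ge0.
    have [i0 hi0] := @hidx_ex N 0 (leq0n _).
    rewrite (bigD1 i0)//= hi0 eqxx big1 ?addr0// => i ii0.
    by rewrite -hi0 (inj_eq (@hidx_inj N)) (negPf ii0).
  apply: schur_test.
  - by rewrite mulr_ge0.
  - by move=> i l; rewrite mulr_ge0 ?edecay_ge0.
  - by move=> i; rewrite -mulr_sumr ler_wpM2l// sum_edecay_hidxB.
  - move=> l; rewrite -mulr_sumr ler_wpM2l//.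
    by under eq_bigr do rewrite -edecayN opprB; exact: sum_edecay_hidxB.
(* By [be_small] the perturbation is at most half of the weighted norm; moving it to the left
   doubles [M * vnorm b]. *)
have yle : l2 (fun i => vnorm (y i)) <= 2 * M * vnorm b.
  have y0 := l2_ge0 (fun i => vnorm (y i)).
  have := ler_wpM2r y0 be_small; rewrite -/s.
  by move: ylt; rewrite mulrDr !mulrA; lra.
move=> i; rewrite xE vnormZ cnorm_toC (gtr0_norm (edecay_gt0 _ _)) mulrC.
rewrite ler_wpM2r ?edecay_ge0//; apply: le_trans yle.
by have := ler_l2 (fun i => vnorm (y i)) i; rewrite ger0_norm ?vnorm_ge0.
Qed.

End HarmonicResolvent.

(** * Comparison of two truncations by zero padding *)

Section ResolventComparison.
Variables (R : realType) (n : nat) (w0 wf : R).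
Local Notation "J ^[ k ]" := (fourier_coef w0 J k) (at level 2, format "J ^[ k ]").

Lemma HR_solution_ex (m : nat) (J : R -> 'M[R[i]]_n) N (B : 'M[R[i]]_(n, m)) (v : 'cV[R[i]]_m) :
  L_HR w0 wf J N \in unitmx ->
  exists2 x, HR_solution w0 wf J (B *m v) x &
    invmx (L_HR w0 wf J N) *m B_HR B N *m v = \mxcol_i x i.
Proof.
move=> Lu; set X := _ *m B_HR B N *m v; pose x i := submxcol X i.
have XE : X = \mxcol_i x i by rewrite submxcolK.
exists x => // i.
have := L_HR_mul w0 wf J x; rewrite -XE /X mulmxA mulKVmx// /B_HR mxcol_mul => /eq_mxcolP h.
by rewrite -(h i); case: ifP => // _; rewrite mul0mx.
Qed.

Variables (C M al be : R).
Hypotheses (C_gt0 : 0 < C) (M_gt0 : 0 < M) (al_gt0 : 0 < al) (be_gt0 : 0 < be).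
Hypothesis be_le : be <= al / 4.

Let be2_le : be + be <= al.
Proof. by move: be_le al_gt0; lra. Qed.

(** The sum has one term if [|k| <= N] and none otherwise: extension by zero without a case
    distinction on ordinals. *)
Definition pad N (x : 'I_(2 * N + 1) -> 'cV[R[i]]_n) (k : int) : 'cV[R[i]]_n :=
  \sum_(i | hidx i == k) x i.

Lemma pad_hidx N (x : 'I_(2 * N + 1) -> 'cV[R[i]]_n) i : pad x (hidx i) = x i.
Proof.
rewrite /pad (big_pred1 i)// => l; exact: (inj_eq (@hidx_inj N)).
Qed.

Lemma pad_eq0 N (x : 'I_(2 * N + 1) -> 'cV[R[i]]_n) k : (N < `|k|)%N -> pad x k = 0.
Proof.
move=> Nk; rewrite /pad big1// => i /eqP ik; move: Nk.
by rewrite -ik ltnNge absz_hidx.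
Qed.

(** Half of the rate in [N] is traded for decay in [k], so that residuals can be summed over all
    rows of the larger system with a bound independent of [N']. *)
Lemma expR_edecay_split (a : R) N k : 0 <= a -> (`|k| <= N)%N ->
  expR (- a * N%:R) <= expR (- (a / 2) * N%:R) * edecay (a / 2) k.
Proof.
move=> a0 kN; rewrite -expRD ler_expR -intr_norm -natr_absz.
have : (`|k|%N)%:R <= N%:R :> R by rewrite ler_nat.
by nra.
Qed.

Lemma edecay_split (a : R) N k : 0 <= a -> (N <= `|k|)%N ->
  edecay a k <= expR (- (a / 2) * N%:R) * edecay (a / 2) k.
Proof.
move=> a0 Nk; rewrite {1}[a]splitr edecayD ler_wpM2r ?edecay_ge0//.
by apply: edecay_far => //; rewrite divr_ge0.
Qed.

Section TruncationDifference.
Variables (J J' : R -> 'M[R[i]]_n) (N N' : nat) (b : 'cV[R[i]]_n).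
Variables (x : 'I_(2 * N + 1) -> 'cV[R[i]]_n) (x' : 'I_(2 * N' + 1) -> 'cV[R[i]]_n).
Hypothesis NN' : (N <= N')%N.
Hypothesis hJ' : forall k v, vnorm (J'^[k] *m v) <= C * edecay al k * vnorm v.
Hypothesis hJJ' : forall k v,
  vnorm ((J^[k] - J'^[k]) *m v) <= 2 * C * expR (- al * N%:R) * vnorm v.
Hypothesis Lu : L_HR w0 wf J' N' \in unitmx.
Hypothesis LM : opnorm (invmx (L_HR w0 wf J' N')) <= M.
Hypothesis hx : HR_solution w0 wf J b x.
Hypothesis hx' : HR_solution w0 wf J' b x'.
Variable X : R.
Hypothesis X_ge0 : 0 <= X.
Hypothesis x_decay : forall i, vnorm (x i) <= X * edecay be (hidx i).

Let z (i : 'I_(2 * N' + 1)) : 'cV[R[i]]_n := pad x (hidx i).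

Lemma vnorm_pad : vnorm (\mxcol_i z i) = vnorm (\mxcol_i x i).
Proof.
rewrite !vnorm_mxcol /l2; congr Num.sqrt.
rewrite (sum_hidx_widen (G := fun k => vnorm (pad x k) ^+ 2) NN').
  by apply: eq_bigr => i _; rewrite pad_hidx.
by move=> k kN; rewrite pad_eq0// vnorm0 expr0n.
Qed.

(** In a row with [|k| <= N] the equation of [x] cancels everything but [J - J']. In an outer row
    the padded vector vanishes, and what remains is the coupling of [J'] to the low harmonics, small
    because either [k - l] or [l] is large. *)
Lemma pad_residual_le i :
  vnorm (freq w0 wf (hidx i) *: z i - \sum_l J'^[hidx i - hidx l] *m z l -
     (if hidx i == 0 then b else 0)) <=
  2 * C * X * gsum be * expR (- (be / 2) * N%:R) * edecay (be / 2) (hidx i).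
Proof.
set k := hidx i.
have C0 := ltW C_gt0; have be0 := ltW be_gt0.
have -> : \sum_l J'^[k - hidx l] *m z l = \sum_(l < 2 * N + 1) J'^[k - hidx l] *m x l.
  rewrite (sum_hidx_widen (G := fun q => J'^[k - q] *m pad x q) NN').
    by apply: eq_bigr => l _; rewrite pad_hidx.
  by move=> q qN; rewrite pad_eq0// mulmx0.
have [kN|Nk] := leqP `|k| N.
  have [q qk] := hidx_ex kN.
  have -> : freq w0 wf k *: z i = \sum_l J^[k - hidx l] *m x l + (if k == 0 then b else 0).
    by rewrite /z -/k -qk pad_hidx -(hx q) addrC subrK.
  rewrite addrAC addrK -sumrB; under eq_bigr do rewrite -mulmxBl.
  apply: le_trans (vnorm_sum _ _ _) _.
  apply: (@le_trans _ _ (\sum_(l < 2 * N + 1) 2 * C * expR (- al * N%:R) * (X * edecay be (hidx l)))).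
    apply: ler_sum => l _; apply: le_trans (hJJ' _ _) _.
    by rewrite ler_wpM2l ?mulr_ge0 ?expR_ge0.
  rewrite -!mulr_sumr.
  have h1 := sum_edecay_hidx N be_gt0.
  have h2 : expR (- al * N%:R) <= expR (- (be / 2) * N%:R) * edecay (be / 2) k.
    apply: le_trans (expR_edecay_split be0 kN).
    by rewrite ler_expR ler_wpM2r// lerN2; apply: le_trans be2_le; rewrite lerDl.
  have -> : 2 * C * expR (- al * N%:R) * (X * \sum_(l < 2 * N + 1) edecay be (hidx l)) =
     2 * C * X * ((\sum_(l < 2 * N + 1) edecay be (hidx l)) * expR (- al * N%:R)) by ring.
  rewrite -[leRHS]mulrA -[leRHS]mulrA ler_wpM2l ?mulr_ge0// ler_pM ?expR_ge0//.
  by apply: sumr_ge0 => l _; exact: edecay_ge0.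
have -> : (if k == 0 then b else 0) = 0 by case: eqP => // k0; rewrite k0 in Nk.
rewrite /z -/k pad_eq0// scaler0 sub0r subr0 vnormN.
apply: le_trans (vnorm_sum _ _ _) _.
apply: (@le_trans _ _ (\sum_(l < 2 * N + 1) C * X * edecay be k * edecay be (k - hidx l))).
  apply: ler_sum => l _; apply: le_trans (hJ' _ _) _.
  apply: le_trans (ler_wpM2l _ (x_decay l)) _; first by rewrite mulr_ge0 ?edecay_ge0.
  (* One copy of [be] carries the decay of [x] from [l] over to [k]; the other makes the sum over
     [l] converge. *)
  have h1 : edecay al (k - hidx l) <= edecay be (k - hidx l) * edecay be (k - hidx l).
    by rewrite -edecayD le_edecay.
  have h2 := edecay_triangle k (hidx l) be0.
  have -> : C * edecay al (k - hidx l) * (X * edecay be (hidx l)) =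
     C * X * (edecay al (k - hidx l) * edecay be (hidx l)) by ring.
  rewrite -[leRHS]mulrA ler_wpM2l ?mulr_ge0//.
  apply: le_trans (ler_wpM2r (edecay_ge0 _ _) h1) _.
  by rewrite -mulrA mulrC ler_wpM2r ?edecay_ge0.
rewrite -mulr_sumr.
have h1 := sum_edecay_hidxB N k be_gt0.
have h2 := edecay_split be0 (ltnW Nk).
have -> : C * X * edecay be k * (\sum_(l < 2 * N + 1) edecay be (k - hidx l)) =
   C * X * ((\sum_(l < 2 * N + 1) edecay be (k - hidx l)) * edecay be k) by ring.
rewrite -[leRHS]mulrA -[leRHS]mulrA.
apply: (@le_trans _ _ (C * X * (gsum be * (expR (- (be / 2) * N%:R) * edecay (be / 2) k)))).
  rewrite ler_wpM2l ?mulr_ge0// ler_pM ?edecay_ge0//.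
  by apply: sumr_ge0 => l _; exact: edecay_ge0.
have G0 := ltW (gsum_gt0 be_gt0).
rewrite ler_wpM2r ?mulr_ge0 ?expR_ge0 ?edecay_ge0//.
by rewrite -mulrA ler_peMl ?mulr_ge0// ler1n.
Qed.

(** Stability of the larger system turns the small residual of the padded vector into a small
    distance to [x']. *)
Lemma HR_truncation_difference :
  `|vnorm (\mxcol_i x i) - vnorm (\mxcol_i x' i)| <=
  M * (2 * C * X * gsum be * expR (- (be / 2) * N%:R) * gsum (be / 2)).
Proof.
rewrite -vnorm_pad; apply: le_trans (ler_dist_vnorm _ _) _.
apply: le_trans (vnorm_invmx_le _ Lu LM) _; rewrite ler_wpM2l ?(ltW M_gt0)//.
rewrite mulmxBr !L_HR_mul -mxcolB vnorm_mxcol.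
have X0 := X_ge0; have C0 := ltW C_gt0; have be0 := ltW be_gt0.
apply: le_trans (l2_le_sum _) _ => [i|]; first exact: vnorm_ge0.
apply: (@le_trans _ _ (\sum_(i < 2 * N' + 1)
  2 * C * X * gsum be * expR (- (be / 2) * N%:R) * edecay (be / 2) (hidx i))).
  by apply: ler_sum => i _; rewrite (hx' i); exact: pad_residual_le.
have be20 : 0 < be / 2 by rewrite divr_gt0.
have G0 := ltW (gsum_gt0 be_gt0).
by rewrite -mulr_sumr ler_wpM2l ?sum_edecay_hidx// !mulr_ge0 ?expR_ge0.
Qed.

End TruncationDifference.

End ResolventComparison.

(** * Comparison of the harmonic and time-spectral resolvents *)

Section TimeSpectral.
Variables (R : realType) (n : nat) (w0 wf : R).
Hypothesis w0_gt0 : 0 < w0.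
Local Notation "J ^[ k ]" := (fourier_coef w0 J k) (at level 2, format "J ^[ k ]").

Lemma L_TS_mul (J : R -> 'M[R[i]]_n) p (u : 'I_p -> 'cV[R[i]]_n) :
  L_TS w0 wf J p *m \mxcol_i u i =
  \mxcol_i ((jC * toC wf) *: u i - J (gridpt R p i / w0) *m u i +
            \sum_k toC (w0 * Dspec p i k) *: u k).
Proof.
rewrite /L_TS /J_TS -(mxdiagZ (p_ := fun=> n)) !mulmxBl !mul_mxdiag_mxcol.
rewrite mul_mxblock_mxrow -!mxcolB; apply: eq_mxcol => i.
rewrite mul_scalar_mx opprB addrA addrAC; congr (_ - _ + _).
by apply: eq_bigr => k _; rewrite mul_scalar_mx.
Qed.

Variables (N : nat) (J : R -> 'M[R[i]]_n) (b : 'cV[R[i]]_n).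
Local Notation p := (2 * N + 1)%N.
Variable x : 'I_p -> 'cV[R[i]]_n.

(** The factor [c] makes the sampling [u] isometric and is also the normalisation in [B_TS]. *)
Let c : R := (Num.sqrt p%:R)^-1.
Let E (k i : 'I_p) : R[i] := expj ((hidx k)%:~R * gridpt R p i).
Let u (i : 'I_p) : 'cV[R[i]]_n := toC c *: \sum_k E k i *: x k.

Let p_gt0 : 0 < p%:R :> R.
Proof. by rewrite ltr0n addn1. Qed.

Let c_gt0 : 0 < c.
Proof. by rewrite invr_gt0 sqrtr_gt0. Qed.

Let c_sqr : p%:R * c ^+ 2 = 1.
Proof. by rewrite exprVn sqr_sqrtr ?(ltW p_gt0)// mulfV// gt_eqF. Qed.

Lemma vnorm_dft : vnorm (\mxcol_i u i) = vnorm (\mxcol_i x i).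
Proof.
rewrite !vnorm_mxcol /l2; congr Num.sqrt.
transitivity (\sum_(i < p) \sum_(r < n) c ^+ 2 * cnorm (\sum_k E k i * x k r 0) ^+ 2).
  apply: eq_bigr => i _; rewrite vnormE l2_sqr; apply: eq_bigr => r _.
  rewrite mxE cnormM cnorm_toC gtr0_norm// exprMn summxE; congr (_ * cnorm _ ^+ 2).
  by apply: eq_bigr => k _; rewrite mxE.
rewrite exchange_big /=; transitivity (\sum_(r < n) \sum_(k < p) cnorm (x k r 0) ^+ 2).
  apply: eq_bigr => r _; rewrite -mulr_sumr.
  rewrite (dft_isometry_scalar N%:Z (fun k => x k r 0)).
  by rewrite mulrA [c ^+ 2 * _]mulrC c_sqr mul1r.
rewrite exchange_big /=; apply: eq_bigr => k _.
by rewrite vnormE l2_sqr.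
Qed.

Hypothesis hx : HR_solution w0 wf J b x.

(** The Fourier series of [J] at a grid time, cut to the window that harmonic [q] sees, minus [J]
    itself: the truncation error acting on [x q]. *)
Let A (i q : 'I_p) : 'M[R[i]]_n :=
  \sum_(l < p) expj ((hidx l - hidx q)%:~R * gridpt R p i) *: J^[hidx l - hidx q]
  - J (gridpt R p i / w0).

Lemma TS_residual i :
  (jC * toC wf) *: u i - J (gridpt R p i / w0) *m u i +
    \sum_k toC (w0 * Dspec p i k) *: u k - toC c *: b =
  toC c *: \sum_q E q i *: (A i q *m x q).
Proof.
(* Differentiation is exact here because [|hidx l| <= N]. *)
have e3 : \sum_k toC (w0 * Dspec p i k) *: u k =
    toC c *: \sum_l (E l i * (jC * toC ((hidx l)%:~R * w0))) *: x l.
  rewrite scaler_sumr /u.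
  under eq_bigr do rewrite scalerA mulrC scaler_sumr.
  rewrite exchange_big /=; apply: eq_bigr => l _.
  under eq_bigr do rewrite scalerA.
  rewrite -scaler_suml scalerA; congr (_ *: _).
  under eq_bigr => k _ do rewrite toCM -!mulrA.
  rewrite -mulr_sumr; congr (_ * _); rewrite -mulr_sumr Dspec_expj ?absz_hidx//.
  by rewrite -/(E l i) toCM toC_int; ring.
have e2 : J (gridpt R p i / w0) *m u i = toC c *: \sum_q E q i *: (J (gridpt R p i / w0) *m x q).
  rewrite /u -scalemxAr mulmx_sumr; congr (_ *: _).
  by apply: eq_bigr => q _; rewrite -scalemxAr.
have e1 : (jC * toC wf) *: u i = toC c *: \sum_l (E l i * (jC * toC wf)) *: x l.
  rewrite /u scalerA mulrC -scalerA; congr (_ *: _); rewrite scaler_sumr.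
  by apply: eq_bigr => l _; rewrite scalerA mulrC.
(* The harmonic equations, row [l] multiplied by [E l i] and summed; only harmonic 0 is forced, and
   its exponential is 1. *)
have e13 : \sum_l (E l i * (jC * toC wf)) *: x l +
    \sum_l (E l i * (jC * toC ((hidx l)%:~R * w0))) *: x l =
    \sum_l E l i *: (\sum_q J^[hidx l - hidx q] *m x q) + b.
  rewrite -big_split /=.
  transitivity (\sum_l E l i *: (\sum_q J^[hidx l - hidx q] *m x q +
     (if hidx l == 0 then b else 0))).
    apply: eq_bigr => l _; rewrite -(hx l) [X in _ = _ *: X]addrC subrK scalerA -scalerDl; congr (_ *: _).
    by rewrite /freq toCD; ring.
  under [LHS]eq_bigr do rewrite scalerDr.
  rewrite big_split /=; congr (_ + _).
  have [i0 hi0] := @hidx_ex N 0 (leq0n _).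
  rewrite (bigD1 i0)//= hi0 eqxx /E hi0 mul0r expj0 scale1r big1 ?addr0// => l li0.
  by rewrite -hi0 (inj_eq (@hidx_inj N)) (negPf li0) scaler0.
rewrite e1 e2 e3 [X in X - _]addrAC -scalerDr e13 -scalerBr -scalerBr; congr (_ *: _).
(* Factoring [E l i] through [E q i] leaves the exponential of harmonic [l - q], which completes the
   truncated series in [A i q]. *)
rewrite addrAC addrK; under eq_bigr do rewrite scaler_sumr.
rewrite exchange_big -sumrB; apply: eq_bigr => q _ /=.
rewrite /A mulmxBl scalerBr mulmx_suml scaler_sumr; congr (_ - _).
apply: eq_bigr => l _; rewrite -scalemxAl scalerA; congr (_ *: _).
by rewrite /E -expjD; congr expj; rewrite [(hidx l - hidx q)%:~R]rmorphB /=; ring.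
Qed.

Variables (C al be X : R).
Hypotheses (C_gt0 : 0 < C) (al_gt0 : 0 < al) (be_gt0 : 0 < be) (be_le : be <= al / 4).

Let be_le_al : be <= al.
Proof. by move: be_le al_gt0; lra. Qed.

Hypothesis J_cont : cont_periodic w0 J.
Hypothesis hJ : forall k, opnorm J^[k] <= C * edecay al k.
Hypothesis X_ge0 : 0 <= X.
Hypothesis x_decay : forall i, vnorm (x i) <= X * edecay be (hidx i).

(** The window of [A i q] is centred at [- hidx q] with radius [N], hence contains every harmonic of
    modulus below [N - |hidx q|]. *)
Lemma entrysum_A_le i q :
  entrysum (A i q) <=
    n%:R * n%:R * (2 * C * gsum (al / 2)) * expR (- (al / 2) * (N - `|hidx q|)%N%:R).
Proof.
rewrite -mulrA; set K := _ * expR _.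
suff h r s : cnorm (A i q r s) <= K.
  apply: (@le_trans _ _ (\sum_(r < n) \sum_(s < n) K)).
    by apply: ler_sum => r _; apply: ler_sum => s _.
  by rewrite !sumr_const !card_ord -[K *+ n]mulr_natl -[_ *+ n]mulr_natl mulrA.
have [Jc Jp] := J_cont.
pose f t := J t r s; pose t0 : R := gridpt R p i / w0.
have w0n : w0 != 0 by rewrite gt_eqF.
pose sq := [seq hidx l - hidx q | l <- enum 'I_p].
have -> : A i q r s = - (f t0 - \sum_(m <- sq) fcoef w0 f m * expj (m%:~R * w0 * t0)).
  rewrite /A !mxE [RHS]opprB summxE; congr (_ - _).
  rewrite big_map big_enum; apply: eq_bigr => l _; rewrite mxE mulrC; congr (_ * expj _).
    by rewrite mxE.
  by rewrite -[RHS]mulrA [w0 * _]mulrC divfK.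
rewrite cnormN; apply: fourier_partial_sum => //.
- exact: Jc.
- by have := Jp 0; rewrite add0r /f => ->.
- exact: ltW.
- move=> k; have -> : fcoef w0 f k = J^[k] r s by rewrite mxE.
  exact: le_trans (cnorm_le_opnorm _ _ _) (hJ k).
- rewrite map_inj_uniq ?enum_uniq// => l l' /addIr; exact: hidx_inj.
- move=> k kd; have hq : (`|(k + hidx q)%R| <= N)%N by have := absz_hidx q; lia.
  have [l hl] := hidx_ex hq; apply/mapP; exists l; first by rewrite mem_enum.
  by rewrite hl addrK.
- have pi0 := pi_gt0 R.
  apply/andP; split; first by rewrite !divr_ge0 ?mulr_ge0 ?(ltW pi0) ?(ltW w0_gt0) ?ler0n.
  rewrite /t0 /period ler_pM2r ?invr_gt0// /gridpt ler_pdivrMr// ler_pM2l ?mulr_gt0//.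
  by rewrite ler_nat ltnW.
Qed.

Lemma TS_difference (K : R) (y : 'cV[R[i]]_(\sum_(i < p) n)) :
  0 <= K -> L_TS w0 wf J p \in unitmx -> opnorm (invmx (L_TS w0 wf J p)) <= K ->
  L_TS w0 wf J p *m y = \mxcol_i (toC c *: b) ->
  `|vnorm y - vnorm (\mxcol_i x i)| <=
  K * (n%:R * n%:R * (2 * C * gsum (al / 2)) * X * gsum (be / 2) * expR (- (be / 2) * N%:R)).
Proof.
move=> K0 Lu LK Ly; rewrite -vnorm_dft distrC; apply: le_trans (ler_dist_vnorm _ _) _.
apply: le_trans (vnorm_invmx_le _ Lu LK) _; rewrite ler_wpM2l//.
rewrite mulmxBr L_TS_mul Ly -mxcolB vnorm_mxcol.
set D := n%:R * n%:R * (2 * C * gsum (al / 2)); set F := D * X * _ * _.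
have be20 : 0 < be / 2 by rewrite divr_gt0.
have al20 : 0 < al / 2 by rewrite divr_gt0.
have D0 : 0 <= D.
  have G0 := ltW (gsum_gt0 al20); have C0 := ltW C_gt0.
  by rewrite !mulr_ge0 ?ler0n.
have F0 : 0 <= F.
  have G0 := ltW (gsum_gt0 be20); have DX := mulr_ge0 D0 X_ge0.
  exact: mulr_ge0 (mulr_ge0 DX G0) (expR_ge0 _).
(* The [p] equal entries [c * F] have norm [F] since [p * c ^+ 2 = 1], so the dimension does not
   enter. *)
apply: (@le_trans _ _ (l2 (fun i : 'I_p => c * F))); last first.
  rewrite /l2 sumr_const card_ord exprMn -mulr_natl mulrA c_sqr mul1r sqrtr_sqr.
  by rewrite ger0_norm.
apply: le_l2 => i; rewrite vnorm_ge0 /= TS_residual vnormZ cnorm_toC gtr0_norm//.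
rewrite ler_pM2l//; apply: le_trans (vnorm_sum _ _ _) _.
(* The window error is small for low [q] and [x q] is small for high [q]; as [be <= al], the product
   always yields the rate [be / 2] in both [N] and [q]. *)
apply: (@le_trans _ _ (\sum_(q < p) D * X * expR (- (be / 2) * N%:R) * edecay (be / 2) (hidx q))).
  apply: ler_sum => q _; rewrite vnormZ cnorm_expj mul1r.
  apply: le_trans (vnorm_mul_entrysum _ _) _.
  apply: le_trans (ler_pM _ (vnorm_ge0 _) (entrysum_A_le _ _) (x_decay _)) _.
    by apply: sumr_ge0 => r _; apply: sumr_ge0 => s _; exact: cnorm_ge0.
  rewrite -/D; set e1 := expR _; set e2 := edecay be _.
  have -> : D * e1 * (X * e2) = D * X * (e1 * e2) by ring.
  rewrite -[leRHS]mulrA ler_wpM2l ?(mulr_ge0 D0 X_ge0)// /e1 /e2 /edecay -!expRD ler_expR.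
  rewrite -intr_norm -natr_absz natrB ?absz_hidx//.
  have hN : 0 <= N%:R - (`|hidx q|%N)%:R :> R by rewrite subr_ge0 ler_nat absz_hidx.
  have ab : 0 <= al / 2 - be / 2 by rewrite subr_ge0 ler_pM2r ?invr_gt0.
  rewrite -subr_ge0; set y1 : R := N%:R; set h : R := (`|hidx q|%N)%:R.
  have -> : - (be / 2) * y1 + - (be / 2) * h - (- (al / 2) * (y1 - h) + - be * h) =
    (al / 2 - be / 2) * (y1 - h) by field.
  exact: mulr_ge0.
rewrite -mulr_sumr /F [leRHS]mulrAC ler_wpM2l ?sum_edecay_hidx//.
exact: mulr_ge0 (mulr_ge0 D0 X_ge0) (expR_ge0 _).
Qed.

End TimeSpectral.

(** * Exponential Cauchy rates pass to the limit *)

Section Limit.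
Variable R : realType.

Lemma expR_rate_eventually_lt (c g e : R) : 0 < g -> 0 < e ->
  exists2 N0, (1 <= N0)%N & `|c| * expR (- g * N0%:R) < e.
Proof.
move=> g0 e0; pose q : R := `|c| / (e * g); exists (Num.truncn q).+1 => //.
set N0 := (Num.truncn q).+1; have qN : q < N0%:R by exact: truncnS_gt.
have eg : 0 < e * g by rewrite mulr_gt0.
have h1 : `|c| < e * (g * N0%:R) by move: qN; rewrite /q ltr_pdivrMr// mulrC mulrA.
have h2 := expR_ge1Dx (g * N0%:R).
rewrite mulNr expRN ltr_pdivrMr ?expR_gt0//; apply: lt_le_trans h1 _.
by rewrite ler_pM2l//; apply: le_trans h2; rewrite lerDr.
Qed.

(** [limn] has a value for every sequence, so convergence is first derived from completeness; the
    bound then survives the passage to the limit in [N']. *)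
Lemma dist_limn_le (s : nat -> R) (c g : R) : 0 < g ->
  (forall N N', (1 <= N)%N -> (N <= N')%N -> `|s N - s N'| <= c * expR (- g * N%:R)) ->
  forall N, (1 <= N)%N -> `|s N - limn s| <= c * expR (- g * N%:R).
Proof.
move=> g0 hs N N1.
have sc : cvgn s.
  apply/cauchy_cvgP/cauchy_exP => e e0.
  have [N0 N01 h] := expR_rate_eventually_lt c g0 e0.
  exists (s N0); suff : \forall N' \near \oo, ball (s N0) e (s N') by [].
  near=> N'; rewrite -ball_normE /=.
  apply: le_lt_trans (hs N0 N' N01 _) _; first by near: N'; exact: nbhs_infty_ge.
  by apply: le_lt_trans h; rewrite ler_wpM2r ?expR_ge0// ler_norm.
have sN : (fun N' => `|s N - s N'|) @ \oo --> `|s N - limn s|.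
  by apply: cvg_norm; apply: cvgB; [exact: cvg_cst|exact: sc].
rewrite -(cvg_lim _ sN)//; apply: limr_le; first by apply/cvg_ex; eexists; exact: sN.
by near=> N'; apply: hs => //; near: N'; exact: nbhs_infty_ge.
Unshelve. all: by end_near. Qed.

End Limit.

(** * Exponential rates for the singular values *)

Section Rates.
Variables (R : realType) (n m : nat) (B : 'M[R[i]]_(n, m)) (w0 wf : R).
Hypotheses (w0_gt0 : 0 < w0) (m_gt0 : (0 < m)%N).
Variables (J : nat -> R -> 'M[R[i]]_n) (Jinf : R -> 'M[R[i]]_n) (C M al be : R).
Hypotheses (C_gt0 : 0 < C) (M_gt0 : 0 < M) (al_gt0 : 0 < al) (be_gt0 : 0 < be).
Hypothesis be_le : be <= al / 4.
Hypothesis be_small : M * (C * (be * (4 / al)) * gsum (al / 2)) <= 1 / 2.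
Local Notation "J ^[ k ]" := (fourier_coef w0 J k) (at level 2, format "J ^[ k ]").
Hypothesis J1 : forall N, (1 <= N)%N -> forall k, opnorm (J N)^[k] <= C * edecay al k.
Hypothesis J3 : forall N, (1 <= N)%N ->
  L_HR w0 wf (J N) N \in unitmx /\ opnorm (invmx (L_HR w0 wf (J N) N)) <= M.

Let J1v N k v : (1 <= N)%N -> vnorm ((J N)^[k] *m v) <= C * edecay al k * vnorm v.
Proof.
move=> N1; apply: le_trans (vnorm_mul_opnorm _ _) _.
by rewrite ler_wpM2r ?vnorm_ge0// J1.
Qed.

Let solution_decay N v x : (1 <= N)%N -> HR_solution w0 wf (J N) (B *m v) x ->
  forall i : 'I_(2 * N + 1), vnorm (x i) <= 2 * M * opnorm B * vnorm v * edecay be (hidx i).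
Proof.
move=> N1 hx i; have [Lu LM] := J3 N1.
apply: le_trans (HR_solution_decay C_gt0 M_gt0 al_gt0 be_gt0 be_le be_small _ Lu LM hx i) _.
  by move=> k z; exact: J1v.
rewrite ler_wpM2r ?edecay_ge0// -[leRHS]mulrA ler_wpM2l ?mulr_ge0 ?(ltW M_gt0)//.
exact: vnorm_mul_opnorm.
Qed.

Let bound_ge0 (v : 'cV[R[i]]_m) : 0 <= 2 * M * opnorm B * vnorm v.
Proof.
rewrite -mulrA; apply: mulr_ge0; first by rewrite mulr_ge0 ?(ltW M_gt0).
exact: le_trans (vnorm_ge0 _) (vnorm_mul_opnorm B v).
Qed.

Hypothesis J2 : forall N, (1 <= N)%N -> forall k : int, `|k| <= N%:Z ->
  opnorm ((J N)^[k] - Jinf^[k]) <= C * expR (- al * N%:R).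

(** For [|k| <= N] both coefficients are compared with those of [Jinf] by [J2]; beyond [N], each is
    already below [C * expR (- al * N)] by [J1]. *)
Let coef_difference N N' k v : (1 <= N)%N -> (N <= N')%N ->
  vnorm (((J N)^[k] - (J N')^[k]) *m v) <= 2 * C * expR (- al * N%:R) * vnorm v.
Proof.
move=> N1 NN'; have N'1 := leq_trans N1 NN'.
have C0 := ltW C_gt0; have al0 := ltW al_gt0; have v0 := vnorm_ge0 v.
have split2 (a b : 'cV[R[i]]_n) : vnorm a <= C * expR (- al * N%:R) * vnorm v ->
    vnorm b <= C * expR (- al * N%:R) * vnorm v ->
    vnorm (a - b) <= 2 * C * expR (- al * N%:R) * vnorm v.
  by move=> ha hb; apply: le_trans (vnormD _ _) _; rewrite vnormN; lra.
have [kN|Nk] := leqP `|k| N.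
  have -> : ((J N)^[k] - (J N')^[k]) *m v =
      ((J N)^[k] - Jinf^[k]) *m v - ((J N')^[k] - Jinf^[k]) *m v.
    by rewrite -mulmxBl opprB addrA subrK.
  apply: split2; apply: le_trans (vnorm_mul_opnorm _ _) _; rewrite ler_wpM2r//.
    by apply: J2 => //; lia.
  apply: le_trans (J2 N'1 _) _; first by lia.
  by rewrite ler_wpM2l// ler_expR ler_wnM2l ?oppr_le0// ler_nat.
have far : edecay al k <= expR (- al * N%:R) by apply: edecay_far => //; exact: ltnW.
rewrite mulmxBl; apply: split2; apply: le_trans (J1v _ _ _) _ => //.
  by rewrite ler_wpM2r// ler_wpM2l.
by rewrite ler_wpM2r// ler_wpM2l.
Qed.

Lemma sigma_HR_cauchy N N' : (1 <= N)%N -> (N <= N')%N ->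
  `|sigma_HR w0 wf (J N) B N - sigma_HR w0 wf (J N') B N'| <=
  M * (2 * C * (2 * M * opnorm B) * gsum be * gsum (be / 2)) * expR (- (be / 2) * N%:R).
Proof.
move=> N1 NN'; have N'1 := leq_trans N1 NN'.
have [Lu LM] := J3 N1; have [Lu' LM'] := J3 N'1.
apply: sigma_max_dist => // v.
have [x hx ->] := HR_solution_ex B v Lu.
have [x' hx' ->] := HR_solution_ex B v Lu'.
apply: le_trans (HR_truncation_difference C_gt0 M_gt0 al_gt0 be_gt0 be_le NN' _ _ Lu' LM'
  hx hx' (bound_ge0 v) (solution_decay N1 hx)) _.
- by move=> k z; exact: J1v.
- by move=> k z; exact: coef_difference.
by rewrite le_eqVlt; apply/orP; left; apply/eqP; ring.
Qed.

Lemma sigma_TS_HR N (K : R) : (1 <= N)%N -> 0 <= K -> cont_periodic w0 (J N) ->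
  L_TS w0 wf (J N) (2 * N + 1) \in unitmx ->
  opnorm (invmx (L_TS w0 wf (J N) (2 * N + 1))) <= K ->
  `|sigma_TS w0 wf (J N) B N - sigma_HR w0 wf (J N) B N| <=
  K * (n%:R * n%:R * (2 * C * gsum (al / 2)) * (2 * M * opnorm B) * gsum (be / 2)) *
    expR (- (be / 2) * N%:R).
Proof.
move=> N1 K0 Jc TSu TSK; have [Lu LM] := J3 N1.
apply: sigma_max_dist => // v.
have [x hx ->] := HR_solution_ex B v Lu.
apply: le_trans (TS_difference w0_gt0 hx C_gt0 al_gt0 be_gt0 be_le Jc (J1 N1) (bound_ge0 v)
  (solution_decay N1 hx) K0 TSu TSK _) _.
  rewrite mulmxA mulKVmx// /B_TS mxcol_mul.
  by apply: eq_mxcol => i; rewrite -scalemxAl.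
by rewrite le_eqVlt; apply/orP; left; apply/eqP; ring.
Qed.

End Rates.

(* J N = J^(N) for N >= 1 (J 0 is unused); Jinf = J^(infinity).
   The time-spectral operator with n_TS = 2N+1 uses J^(N). *)
Theorem mainTheorem2 (R : realType) (n m : nat) (hn : (0 < n)%N) (hm : (0 < m)%N)
    (B : 'M[R[i]]_(n, m)) (w0 wf : R) (hw0 : 0 < w0)
    (J : nat -> R -> 'M[R[i]]_n) (Jinf : R -> 'M[R[i]]_n)
    (C M alpha : R) (hC : 0 < C) (hM : 0 < M) (halpha : 0 < alpha) :
  (forall N, (1 <= N)%N -> cont_periodic w0 (J N)) ->
  cont_periodic w0 Jinf ->
  (* (J1) *)
  (forall N, (1 <= N)%N -> forall k : int,
     opnorm (fourier_coef w0 (J N) k) <= C * expR (- alpha * `|k%:~R : R|)) ->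
  (forall k : int, opnorm (fourier_coef w0 Jinf k) <= C * expR (- alpha * `|k%:~R : R|)) ->
  (* (J2) *)
  (forall N, (1 <= N)%N -> forall k : int, `|k| <= N%:Z ->
     opnorm (fourier_coef w0 (J N) k - fourier_coef w0 Jinf k)
       <= C * expR (- alpha * N%:R)) ->
  (* (J3) *)
  (forall N, (1 <= N)%N ->
     L_HR w0 wf (J N) N \in unitmx /\ opnorm (invmx (L_HR w0 wf (J N) N)) <= M) ->
  (forall N, (1 <= N)%N -> forall k : int,
     A_k w0 wf (J N) k \in unitmx /\ opnorm (invmx (A_k w0 wf (J N) k)) <= M) ->
  (* analytic extension to a strip, bounded uniformly in N *)
  (exists rho K : R, 0 < rho /\
     (forall N, (1 <= N)%N -> analytic_strip_bounded rho K (J N)) /\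
     analytic_strip_bounded rho K Jinf) ->
  (* time-spectral operators invertible with uniformly bounded inverses *)
  (forall N, (1 <= N)%N -> L_TS w0 wf (J N) (2 * N + 1) \in unitmx) ->
  (exists K : R, forall N, (1 <= N)%N ->
     opnorm (invmx (L_TS w0 wf (J N) (2 * N + 1))) <= K) ->
  exists C' alpha' : R, 0 < C' /\ 0 < alpha' /\
    forall N, (1 <= N)%N ->
      `|sigma_TS w0 wf (J N) B N - limn (fun N => sigma_HR w0 wf (J N) B N)|
        <= C' * expR (- alpha' * (2 * N + 1)%:R).
Proof.
move=> Jc _ J1 _ J2 J3 _ _ TSu [K hK].
(* [c] is the perturbation constant per unit of [be], so [be <= 1 / (2 * c)] brings it to 1/2; the
   cap [alpha / 4] is the one of [weight_bound]. *)
pose c := M * (C * (4 / alpha) * gsum (alpha / 2)).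
have c0 : 0 < c.
  by rewrite /c !mulr_gt0// ?invr_gt0// ?gsum_gt0// divr_gt0.
pose be := Num.min (alpha / 4) (1 / (2 * c)).
have be0 : 0 < be by rewrite lt_min !divr_gt0// mulr_gt0.
have be_le : be <= alpha / 4 by rewrite ge_min lexx.
have be_small : M * (C * (be * (4 / alpha)) * gsum (alpha / 2)) <= 1 / 2.
  have -> : M * (C * (be * (4 / alpha)) * gsum (alpha / 2)) = be * c by rewrite /c; ring.
  apply: (@le_trans _ _ (1 / (2 * c) * c)).
    by rewrite ler_pM2r// ge_min lexx orbT.
  by move: (c) c0 => c' c0; have -> : 1 / (2 * c') * c' = 1 / 2 by field; rewrite gt_eqF.
have hHR := dist_limn_le (divr_gt0 be0 (ltr0n _ 2))
  (sigma_HR_cauchy B hw0 hm hC hM halpha be0 be_le be_small J1 J3 J2).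
have hTS N (N1 : (1 <= N)%N) := sigma_TS_HR B hw0 hm hC hM halpha be0 be_le be_small J1 J3 N1
  (normr_ge0 K) (Jc N N1) (TSu N N1) (le_trans (hK N N1) (ler_norm K)).
set c2 := M * _ in hHR; set c1 := `|K| * _ in hTS.
(* For [N >= 1], [2 * N + 1 <= 3 * N], so the rate [be / 2] in [N] is at least [be / 6] in
   [2 * N + 1]. The added 1 makes the constant positive. *)
exists (`|c1| + `|c2| + 1), (be / 6); split; first by rewrite ltr_pwDr// addr_ge0.
split=> [|N N1]; first by rewrite divr_gt0.
have e1 : expR (- (be / 2) * N%:R) <= expR (- (be / 6) * (2 * N + 1)%:R).
  have N1' : 1 <= N%:R :> R by rewrite ler1n.
  have := ler_wpM2l (ltW be0) N1'; rewrite ler_expR natrD natrM; lra.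
have h3 := ler_distD (sigma_HR w0 wf (J N) B N) (sigma_TS w0 wf (J N) B N)
   (limn (fun N => sigma_HR w0 wf (J N) B N)).
apply: le_trans h3 _; apply: le_trans (lerD (hTS N N1) (hHR N N1)) _.
rewrite -mulrDl; apply: le_trans (ler_wpM2l _ e1); last by rewrite addr_ge0// addr_ge0.
rewrite ler_wpM2r ?expR_ge0//; have := ler_norm c1; have := ler_norm c2; lra.
Qed.
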